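(* Let $\Omega$ be a bounded Borel subset of $\mathbb{R}$ with $|\Omega|=1$. Assume that $\Omega$ has a spectrum $\Lambda$ with period $p\in\mathbb{N}$, $p\geq 1$, and $\Lambda=\{\lambda_0=0,\lambda_1,\dots,\lambda_{p-1}\}+p\mathbb{Z}$. Let $U_\Lambda$ be the one-parameter group of local translations associated to $\Lambda$. Let $T$ be a $p\times p$ unitary matrix with eigenvalues $e_{\lambda_0}(\frac1p),\dots,e_{\lambda_{p-1}}(\frac1p)$. Let $\mathcal{H}_T$ be the Hilbert space $$\mathcal{H}_T=\left\{f:\mathbb{R}\to\mathbb{C}^p : f\text{ measurable},\ \int_0^{1/p}\|f(x)\|_{\mathbb{C}^p}^2\,dx<\infty,\ f(x+\tfrac1p)=Tf(x)\text{ for a.e. }x\in\mathbb{R}\right\}$$ (functions identified when equal a.e.) with inner product $\langle f,g\rangle_{\mathcal{H}_T}=p\int_0^{1/p}\langle f(x),g(x)\rangle_{\mathbb{C}^p}\,dx$, and define the one-parameter group of unitary transformations $(U_T(t)f)(x)=f(x+t)$, $t,x\in\mathbb{R}$, $f\in\mathcal{H}_T$. Then there exists an isometric isomorphism $W$ from $L^2(\Omega)$ onto $\mathcal{H}_T$ that intertwines $U_\Lambda$ and $U_T$, i.e. $WU_\Lambda(t)=U_T(t)W$ for all $t\in\mathbb{R}$.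
   Context: $|\Omega|$ is Lebesgue measure; $e_\lambda(x)=e^{2\pi \mathrm{i}\lambda x}$. $\Omega$ has spectrum $\Lambda\subset\mathbb{R}$ if $\{|\Omega|^{-1/2}e_\lambda:\lambda\in\Lambda\}$ is an orthonormal basis of $L^2(\Omega)$. $\Lambda$ has period $p$ if $\Lambda+p=\Lambda$. The group of local translations associated to $\Lambda$ is the strongly continuous one-parameter unitary group $U_\Lambda$ on $L^2(\Omega)$ determined by $U_\Lambda(t)e_\lambda=e^{2\pi \mathrm{i}\lambda t}e_\lambda$ for $\lambda\in\Lambda$, $t\in\mathbb{R}$. *)

(* Defs.v *)
From HB Require Import structures.
From mathcomp Require Import all_boot all_order all_algebra.
From mathcomp Require Import spectral.
From mathcomp Require Import all_classical all_reals all_analysis.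
From mathcomp Require Import complex.

Set Implicit Arguments.
Unset Strict Implicit.
Unset Printing Implicit Defensive.

Import Order.TTheory GRing.Theory Num.Theory.
Import numFieldNormedType.Exports.

Local Open Scope classical_set_scope.
Local Open Scope ring_scope.

(* A complex Hilbert space of functions modulo a.e. equality, given by its
   representatives: the points are the [f] with [dom f], two of them being
   identified when [same f g]. Maps between such spaces act on representatives,
   are only constrained on [dom], and all identities are up to [same]. *)
Record fspace (R : realType) := FSpace {
  vec : lmodType R[i];
  dom : set vec;
  same : vec -> vec -> Prop;
  dotp : vec -> vec -> R[i] }.

Section Hilbert.
Context {R : realType}.
Implicit Types H : fspace R.

Definition hnorm H (f : vec H) : R := Num.sqrt (complex.Re (dotp f f)).

Definition isometric_iso H1 H2 (W : vec H1 -> vec H2) : Prop :=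
  [/\ forall f, dom f -> dom (W f),
      forall f g, dom f -> dom g -> same f g -> same (W f) (W g),
      forall (a : R[i]) f g, dom f -> dom g ->
        same (W (a *: f + g)) (a *: W f + W g),
      forall f g, dom f -> dom g -> dotp (W f) (W g) = dotp f g
    & forall g, dom g -> exists2 f, dom f & same (W f) g].

Definition unitary_group H (U : R -> vec H -> vec H) : Prop :=
  [/\ forall t, isometric_iso (U t),
      forall f, dom f -> same (U 0 f) f,
      forall s t f, dom f -> same (U (s + t) f) (U s (U t f))
    & forall f, dom f -> forall t0 : R,
        (fun t : R => hnorm (U t f - U t0 f)) @ t0 --> (0 : R)].

Definition orthonormal_basis H (I : eqType) (D : set I) (e : I -> vec H) : Prop :=
  [/\ forall i, D i -> dom (e i),
      forall i j, D i -> D j -> dotp (e i) (e j) = (i == j)%:R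
    & forall f, dom f -> forall eps : R, 0 < eps ->
        exists (s : seq I) (c : I -> R[i]),
          (forall i, i \in s -> D i) /\
          hnorm (f - \sum_(i <- s) c i *: e i) < eps].

End Hilbert.

Section Spaces.
Context {R : realType}.

Local Notation mu := (@lebesgue_measure R).

Definition cmeasurable (D : set R) (f : R -> R[i]) : Prop :=
  measurable_fun D (fun x => complex.Re (f x)) /\
  measurable_fun D (fun x => complex.Im (f x)).

Definition cintegral (D : set R) (f : R -> R[i]) : R[i] :=
  Complex (\int[mu]_(x in D) complex.Re (f x)) (\int[mu]_(x in D) complex.Im (f x)).

(* The functions are total, but only their values on [Omega] matter. *)
Definition L2 (Omega : set R) : fspace R :=
  @FSpace R (R -> R[i]^o)
    [set f : R -> R[i]^o | cmeasurable Omega f /\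
      (\int[mu]_(x in Omega) (complex.Re (`|f x : R[i]| ^+ 2))%:E < +oo)%E]
    (fun f g => {ae mu, forall x, Omega x -> f x = g x})
    (fun f g => cintegral Omega (fun x => (f x : R[i]) * (g x : R[i])^*)).

Definition cdot (n : nat) (u v : 'cV[R[i]]_n) : R[i] :=
  \sum_(i < n) u i 0 * (v i 0)^*.

Definition HT (p : nat) (T : 'M[R[i]]_p) : fspace R :=
  @FSpace R (R -> 'cV[R[i]]_p)
    [set f : R -> 'cV[R[i]]_p | [/\ forall i, cmeasurable setT (fun x => f x i 0),
       (\int[mu]_(x in `[0%R, (p%:R^-1)%R]) (complex.Re (cdot (f x) (f x)))%:E < +oo)%E
     & {ae mu, forall x : R, f (x + p%:R^-1) = T *m f x}]]
    (fun f g => {ae mu, forall x, f x = g x})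
    (fun f g => p%:R * cintegral `[0, p%:R^-1] (fun x => cdot (f x) (g x))).

Definition UT (p : nat) (T : 'M[R[i]]_p) (t : R) (f : vec (HT T)) : vec (HT T) :=
  fun x => f (x + t).

Definition expi (lambda x : R) : R[i] :=
  Complex (cos (2 * pi * lambda * x)) (sin (2 * pi * lambda * x)).

Definition has_spectrum (Omega Lambda : set R) : Prop :=
  orthonormal_basis (H := L2 Omega) Lambda
    (fun lambda x => ((Num.sqrt (fine (mu Omega)))^-1)%:C%C * expi lambda x).

Definition has_period (Lambda : set R) (p : R) : Prop :=
  [set lambda + p | lambda in Lambda] = Lambda.

Definition local_translations (Omega Lambda : set R)
    (U : R -> vec (L2 Omega) -> vec (L2 Omega)) : Prop :=
  unitary_group U /\
  forall lambda t, Lambda lambda ->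
    same (U t (expi lambda)) (fun x => expi lambda t * expi lambda x).

End Spaces.

(* Main.v *)
(** Put a = 1/p. For each j, the exponentials with frequency in lam_j + pZ span
    the subspace whose orthogonal projection is given by Poisson summation:
    f is sent to its "sheet"
      S_j f(x) = a e_{lam_j}(x) sum_{z in x + aZ} (1_Omega f e_{-lam_j})(z),
    which makes sense for all x in R and satisfies S_j f(x+a) =
    e_{lam_j}(a) S_j f(x). Orthonormality of the spectrum says that the a-periodic
    functions sum_{z in x + aZ} (1_Omega e_{lam_i - lam_j})(z) have the Fourier
    coefficients of the constants p delta_ij, hence equal them almost everywhere
    by uniqueness of Fourier coefficients; completeness then gives
    sum_j S_j f = f on Omega. Applied to indicators of cells of length a, this
    shows that the number of classes lam_j + pZ is exactly p, so the lam_j are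
    distinct modulo p and T has simple spectrum. After diagonalizing T by a
    unitary matrix, W f is the vector of sheets of f in the eigenbasis of T;
    uniqueness of Fourier coefficients again yields S_j (U(t) f)(x) =
    S_j f(x+t). *)
From HB Require Import structures.
Require Import Defs.
From mathcomp Require Import all_boot all_order all_algebra.
From mathcomp Require Import spectral.
From mathcomp Require Import all_classical all_reals all_analysis.
From mathcomp Require Import measurable_realfun complex.
From mathcomp Require Import ring lra zify.
Import Order.TTheory GRing.Theory Num.Theory.
Import numFieldNormedType.Exports.
Local Open Scope classical_set_scope.
Local Open Scope ring_scope.

Set Implicit Arguments.
Unset Strict Implicit.
Unset Printing Implicit Defensive.

(** * Translation invariance *)

Section Translation.
Context {R : realType}.
Local Notation mu := (@lebesgue_measure R).
Implicit Types (D : set R) (t : R).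

(** Since [Omega] is bounded it lies in a window of [M.*2] cells of length [a], so each sum over a
    class modulo [a] is finite: sheets are defined at every point, and no convergence of series is
    ever discussed. The obstacle is that the [lam j] are not assumed distinct modulo [p], whereas
    the orthogonality relations between sheets require it. Sheets are therefore studied for an
    arbitrary finite index type whose classes are distinct, and the results are used twice: on a
    system of representatives, where counting shows that there are exactly [p] classes, and then on
    ['I_p] itself. Likewise the eigenvalues of [T] are known only as a set; once they are [p]
    distinct numbers, each has multiplicity one and frequencies can be matched with eigenvectors.
    Isometry and surjectivity of the map from functions to sheets have one source: a sheet is a
    character times a periodic function, and a periodic factor can be moved in and out of a
    periodization. *)

Lemma measurable_shift t : measurable_fun setT (fun x : R => x + t).
Proof. exact: measurable_funD. Qed.

Lemma measurable_preshift t D : measurable D -> measurable [set x | D (x + t)].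
Proof.
by move=> mD; rewrite -[X in measurable X]setTI; exact: measurable_shift.
Qed.

(** By uniqueness of Lebesgue measure it is enough to compare the two measures on half-open
    intervals. *)
Lemma lebesgue_measure_shift t D : measurable D ->
  pushforward mu (fun x : R => x + t : measurableTypeR R) D = mu D.
Proof.
move=> mD; apply/esym/lebesgue_measure_unique => //=.
  exact: measurable_shift.
move=> ? _ [[a b]] _ <-.
rewrite /pushforward (_ : _ @^-1` _ = `]a - t, b - t]%classic).
  by rewrite !lebesgue_measure_itv/= !lte_fin ltrD2r -!EFinB opprB addrA subrK.
by apply/seteqP; split=> x /=; rewrite !in_itv/= ltrBlDr lerBrDr.
Qed.

Lemma lebesgue_measure_preshift t D : measurable D ->
  mu [set x | D (x + t)] = mu D.
Proof. by move=> mD; rewrite -(lebesgue_measure_shift t mD). Qed.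

Lemma measurable_fun_preshift t D d' (T' : measurableType d') (f : R -> T') :
  measurable D ->
  measurable_fun D f -> measurable_fun [set x | D (x + t)] (fun x => f (x + t)).
Proof.
move=> mD mf.
apply: (@measurable_comp _ _ _ _ _ _ D f _ (fun x : R => x + t)) => //.
  by move=> _ [x Dx <-].
exact: measurable_funS (measurable_shift t).
Qed.

Lemma ge0_integral_shift t D (f : R -> \bar R) : measurable D ->
  measurable_fun D f -> (forall x, (0 <= f x)%E) ->
  (\int[mu]_(x in D) f x = \int[mu]_(x in [set x | D (x + t)%R]) f (x + t)%R)%E.
Proof.
move=> mD mf f0.
rewrite -[RHS](@ge0_integral_pushforward _ _ (measurableTypeR R)
  (measurableTypeR R) R _ (measurable_shift t) mu)//.
apply: eq_measure_integral => //.
  exact: measurable_shift.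
by move=> mshift A mA _; apply/esym/lebesgue_measure_shift.
Qed.

Lemma integral_shift t D (f : R -> \bar R) : measurable D ->
  measurable_fun D f ->
  (\int[mu]_(x in D) f x = \int[mu]_(x in [set x | D (x + t)%R]) f (x + t)%R)%E.
Proof.
move=> mD mf; rewrite integralE [RHS]integralE.
congr (_ - _)%E.
  rewrite (ge0_integral_shift t)//; last exact: measurable_funepos.
  by apply: eq_integral => x _; rewrite ?funeposE ?funenegE.
rewrite (ge0_integral_shift t)//; last exact: measurable_funeneg.
by apply: eq_integral => x _; rewrite ?funeposE ?funenegE.
Qed.

Lemma integrable_shift t D (f : R -> \bar R) : measurable D ->
  mu.-integrable D f ->
  mu.-integrable [set x | D (x + t)] (fun x => f (x + t)).
Proof.
move=> mD /integrableP[mf iD]; apply/integrableP; split.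
  exact: measurable_fun_preshift.
rewrite -(@ge0_integral_shift t D (abse \o f)) //=.
by apply: measurableT_comp.
Qed.

Lemma preshift_itvco (c d t : R) :
  [set x : R | `[c, d[%classic (x + t)] = `[c - t, d - t[%classic.
Proof.
by apply/seteqP; split=> x /=; rewrite !in_itv/= lerBlDr ltrBrDr.
Qed.

Lemma ae_shift t (Q : R -> Prop) :
  {ae mu, forall x, Q x} -> {ae mu, forall x, Q (x + t)}.
Proof.
move=> [A [mA A0 QA]]; exists [set x | A (x + t)]; split.
- exact: measurable_preshift.
- by rewrite lebesgue_measure_preshift.
- by move=> x /= /QA.
Qed.

Lemma ae_imply (P Q : R -> Prop) : (forall x, P x -> Q x) ->
  {ae mu, forall x, P x} -> {ae mu, forall x, Q x}.
Proof.
by move=> PQ; apply: filterS => //; exact: (ae_filter_ringOfSetsType mu).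
Qed.

Lemma ae_imply2 (P1 P2 Q : R -> Prop) : (forall x, P1 x -> P2 x -> Q x) ->
  {ae mu, forall x, P1 x} -> {ae mu, forall x, P2 x} -> {ae mu, forall x, Q x}.
Proof.
by move=> PQ; apply: filterS2 => //; exact: (ae_filter_ringOfSetsType mu).
Qed.

Lemma ae_forall (T : countType) (Q : T -> R -> Prop) :
  (forall n, {ae mu, forall x, Q n x}) -> {ae mu, forall x, forall n, Q n x}.
Proof.
move=> h; have : {ae mu, forall x, forall k : nat,
    if @unpickle T k is Some n then Q n x else True}.
  apply: (ae_foralln) => k; case: (unpickle k) => [n|]; first exact: h.
  by apply: aeW.
by apply: ae_imply => x hx n; have := hx (pickle n); rewrite pickleK.
Qed.

(** Periodizations evaluate a function at several points of a class modulo [a]. A countable union of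
    null sets is null, so an almost everywhere identity may be used at all of them at once. *)
Lemma ae_shift_int (a : R) (Q : R -> Prop) : {ae mu, forall x, Q x} ->
  {ae mu, forall x, forall n : int, Q (x + n%:~R * a)}.
Proof. by move=> hQ; apply: ae_forall => n; exact: ae_shift. Qed.

End Translation.

(** * Complex-valued integrals *)

Section ComplexParts.
Context {R : realType}.
Implicit Types x y : R[i].

Lemma ReM x y : complex.Re (x * y) =
  complex.Re x * complex.Re y - complex.Im x * complex.Im y.
Proof. by case: x y => [a b] [c d]. Qed.

Lemma ImM x y : complex.Im (x * y) =
  complex.Re x * complex.Im y + complex.Im x * complex.Re y.
Proof. by case: x y => [a b] [c d]. Qed.

Lemma Re_conj x : complex.Re x^* = complex.Re x.
Proof. by case: x. Qed.

Lemma Im_conj x : complex.Im x^* = - complex.Im x.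
Proof. by case: x. Qed.

Lemma Re_sqr_norm x :
  complex.Re (`|x| ^+ 2) = complex.Re x ^+ 2 + complex.Im x ^+ 2.
Proof. by rewrite normCK ReM Re_conj Im_conj; ring. Qed.

Lemma complex_eq x y :
  complex.Re x = complex.Re y -> complex.Im x = complex.Im y -> x = y.
Proof. by case: x y => [a b] [c d] /= -> ->. Qed.

Lemma conjM x y : (x * y)^* = x^* * y^*.
Proof. exact: rmorphM. Qed.

Lemma complex_realM (r : R) x :
  complex.Re (r%:C%C * x) = r * complex.Re x /\
  complex.Im (r%:C%C * x) = r * complex.Im x.
Proof. by rewrite ReM ImM /= !mul0r subr0 addr0. Qed.

End ComplexParts.

(** * Characters of the real line *)

Section Expi.
Context {R : realType}.
Implicit Types l m x y : R.

Lemma expi_addl l m x : expi (l + m) x = expi l x * expi m x.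
Proof.
by apply: complex_eq; rewrite ?ReM ?ImM /= mulrDr mulrDl ?cosD ?sinD; ring.
Qed.

Lemma expi_sym l x : expi l x = expi x l.
Proof. by rewrite /expi -!mulrA (mulrC l). Qed.

Lemma expi_addr l x y : expi l (x + y) = expi l x * expi l y.
Proof. by rewrite !(expi_sym l) expi_addl. Qed.

Lemma expi0l x : expi 0 x = 1 :> R[i].
Proof. by rewrite /expi mulr0 mul0r cos0 sin0. Qed.

Lemma expi0r l : expi l 0 = 1 :> R[i].
Proof. by rewrite expi_sym expi0l. Qed.

Lemma expiN l x : expi (- l) x = (expi l x)^*.
Proof.
by apply: complex_eq; rewrite ?Re_conj ?Im_conj /= mulrN mulNr ?cosN ?sinN.
Qed.

Lemma expiNr l x : expi l (- x) = (expi l x)^*.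
Proof. by rewrite expi_sym expiN expi_sym. Qed.

Lemma expi_mulN l x : expi l x * expi (- l) x = 1.
Proof. by rewrite -expi_addl subrr expi0l. Qed.

Lemma expi_int (n : int) : expi 1 (n%:~R : R) = 1.
Proof.
have expi_nat (k : nat) : expi 1 (k%:R : R) = 1.
  elim: k => [|k IHk]; first exact: expi0r.
  rewrite -addn1 natrD expi_addr IHk mul1r /expi !mulr1.
  by rewrite mulr_natl cos2pi sin2pi.
case: n => n; first exact: expi_nat.
by rewrite NegzE mulrNz expiNr expi_nat conjC1.
Qed.

Lemma abs_Re_expi l x : `|complex.Re (expi l x)| <= 1.
Proof. by rewrite ler_norml cos_geN1 cos_le1. Qed.

Lemma abs_Im_expi l x : `|complex.Im (expi l x)| <= 1.
Proof. by rewrite ler_norml sin_geN1 sin_le1. Qed.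

End Expi.

Section ComplexIntegral.
Context {R : realType}.
Local Notation mu := (@lebesgue_measure R).
Implicit Types (D : set R) (f g : R -> R[i]).

Lemma cmeasurableD D f g :
  cmeasurable D f -> cmeasurable D g -> cmeasurable D (fun x => f x + g x).
Proof.
move=> [fr fi] [gr gi]; split.
  by under eq_fun do rewrite raddfD; exact: measurable_funD.
by under eq_fun do rewrite raddfD; exact: measurable_funD.
Qed.

Lemma cmeasurableM D f g :
  cmeasurable D f -> cmeasurable D g -> cmeasurable D (fun x => f x * g x).
Proof.
move=> [fr fi] [gr gi]; split.
  under eq_fun do rewrite ReM.
  by apply: measurable_funB; exact: measurable_funM.
under eq_fun do rewrite ImM.
by apply: measurable_funD; exact: measurable_funM.
Qed.

Lemma cmeasurable_cst D (c : R[i]) : cmeasurable D (fun=> c).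
Proof. by split; exact: measurable_cst. Qed.

Lemma cmeasurable_conj D f : cmeasurable D f -> cmeasurable D (fun x => (f x)^*).
Proof.
move=> [fr fi]; split; first by under eq_fun do rewrite Re_conj.
by under eq_fun do rewrite Im_conj; exact: measurable_funN.
Qed.

Lemma cmeasurable_sum D (I : Type) (r : seq I) (F : I -> R -> R[i]) :
  (forall i, cmeasurable D (F i)) -> cmeasurable D (fun x => \sum_(i <- r) F i x).
Proof.
move=> mF; split; under eq_fun do rewrite raddf_sum;
  by apply: measurable_sum => i; case: (mF i).
Qed.

Lemma cmeasurableS D D' f : measurable D' -> D `<=` D' ->
  cmeasurable D' f -> cmeasurable D f.
Proof. by move=> mD' DD' [fr fi]; split; exact: measurable_funS DD' _. Qed.

Lemma cmeasurable_expi D l : cmeasurable D (expi l).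
Proof.
have mlin : measurable_fun D (fun x : R => 2 * pi * l * x).
  by apply: measurable_funM => //; exact: measurable_cst.
split.
  apply: (@measurableT_comp _ _ _ _ _ _ cos) => //.
  by apply: continuous_measurable_fun; exact: continuous_cos.
apply: (@measurableT_comp _ _ _ _ _ _ sin) => //.
by apply: continuous_measurable_fun; exact: continuous_sin.
Qed.

Definition cintegrable D f :=
  mu.-integrable D (EFin \o (fun x => complex.Re (f x))) /\
  mu.-integrable D (EFin \o (fun x => complex.Im (f x))).

Lemma cintegrable_cmeasurable D f : cintegrable D f -> cmeasurable D f.
Proof.
by move=> [/measurable_int/measurable_EFinP fr /measurable_int/measurable_EFinP].
Qed.

Lemma cintegrable_le D f (g : R -> R) : measurable D -> cmeasurable D f ->
  mu.-integrable D (EFin \o g) ->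
  (forall x, D x -> `|complex.Re (f x)| <= g x /\ `|complex.Im (f x)| <= g x) ->
  cintegrable D f.
Proof.
move=> mD [fr fi] ig fg.
split; apply: le_integrable ig => //; try exact/measurable_EFinP.
  by move=> x /fg[h _]; rewrite /= lee_fin (le_trans h)// ler_norm.
by move=> x /fg[_ h]; rewrite /= lee_fin (le_trans h)// ler_norm.
Qed.

Lemma cintegrableM_bounded D f g : measurable D -> cintegrable D f ->
  cmeasurable D g ->
  (forall x, D x -> `|complex.Re (g x)| <= 1 /\ `|complex.Im (g x)| <= 1) ->
  cintegrable D (fun x => f x * g x).
Proof.
move=> mD [fr fi] mg g1.
have mf : cmeasurable D f by exact: cintegrable_cmeasurable.
apply: (@cintegrable_le D _
  (fun x => `|complex.Re (f x)| + `|complex.Im (f x)|)) => //.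
- exact: cmeasurableM.
- rewrite (_ : _ \o _ = (fun x =>
      `|(complex.Re (f x))%:E| + `|(complex.Im (f x))%:E|)%E)//.
  by apply: integrableD => //; exact: integrable_abse.
- move=> x /g1[g1r g1i]; rewrite ReM ImM; split.
    apply: (le_trans (ler_normB _ _)); rewrite !normrM lerD//.
      by rewrite ler_piMr.
    by rewrite ler_piMr.
  apply: (le_trans (ler_normD _ _)); rewrite !normrM lerD//.
    by rewrite ler_piMr.
  by rewrite ler_piMr.
Qed.

Lemma cintegrableM_expi D f l : measurable D -> cintegrable D f ->
  cintegrable D (fun x => f x * expi l x).
Proof.
move=> mD fi; apply: cintegrableM_bounded => //; first exact: cmeasurable_expi.
by move=> x _; rewrite abs_Re_expi abs_Im_expi.
Qed.

Lemma cintegrableD D f g : measurable D ->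
  cintegrable D f -> cintegrable D g -> cintegrable D (fun x => f x + g x).
Proof.
move=> mD [fr fi] [gr gi]; split.
  rewrite (_ : _ \o _ = (fun x => (complex.Re (f x))%:E + (complex.Re (g x))%:E)%E).
    exact: integrableD.
  by apply/funext => x /=; rewrite raddfD.
rewrite (_ : _ \o _ = (fun x => (complex.Im (f x))%:E + (complex.Im (g x))%:E)%E).
  exact: integrableD.
by apply/funext => x /=; rewrite raddfD.
Qed.

Lemma cintegrableZ D f (c : R[i]) : measurable D ->
  cintegrable D f -> cintegrable D (fun x => c * f x).
Proof.
move=> mD [fr fi]; split.
  rewrite (_ : _ \o _ = (fun x => (complex.Re c)%:E * (complex.Re (f x))%:E
      - (complex.Im c)%:E * (complex.Im (f x))%:E)%E).
    by apply: integrableB => //; exact: integrableZl.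
  by apply/funext => x /=; rewrite ReM.
rewrite (_ : _ \o _ = (fun x => (complex.Re c)%:E * (complex.Im (f x))%:E
    + (complex.Im c)%:E * (complex.Re (f x))%:E)%E).
  by apply: integrableD => //; exact: integrableZl.
by apply/funext => x /=; rewrite ImM.
Qed.

Lemma integrable_cst D (k : R) : measurable D -> (mu D < +oo)%E ->
  mu.-integrable D (EFin \o (fun=> k)).
Proof.
move=> mD Dfin; apply: measurable_bounded_integrable => //.
exact: bounded_cst.
Qed.

Lemma cintegrable_cst D (c : R[i]) : measurable D -> (mu D < +oo)%E ->
  cintegrable D (fun=> c).
Proof. by move=> mD Dfin; split; exact: integrable_cst. Qed.

Lemma cintegrable_sum D (I : Type) (r : seq I) (F : I -> R -> R[i]) :
  measurable D -> (forall i, cintegrable D (F i)) ->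
  cintegrable D (fun x => \sum_(i <- r) F i x).
Proof.
move=> mD iF; elim: r => [|i r IHr].
  under eq_fun do rewrite big_nil.
  by split; exact: integrable0.
under eq_fun do rewrite big_cons.
exact: cintegrableD.
Qed.

Lemma cintegrableS D D' f : measurable D -> measurable D' -> D `<=` D' ->
  cintegrable D' f -> cintegrable D f.
Proof.
by move=> mD mD' DD' [fr fi]; split; [move: fr|move: fi]; apply: integrableS.
Qed.

Lemma eq_cintegrable D f g : measurable D -> {in D, f =1 g} ->
  cintegrable D f -> cintegrable D g.
Proof.
by move=> mD fg [fr fi]; split; [apply: eq_integrable fr|apply: eq_integrable fi]
  => // x xD; rewrite /= fg.
Qed.

Lemma eq_cintegral D f g : {in D, f =1 g} -> cintegral D f = cintegral D g.
Proof.
by move=> fg; congr Complex; apply: eq_Rintegral => x xD; rewrite fg.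
Qed.

Lemma cintegralD D f g : measurable D -> cintegrable D f -> cintegrable D g ->
  cintegral D (fun x => f x + g x) = cintegral D f + cintegral D g.
Proof.
move=> mD [fr fi] [gr gi]; rewrite /cintegral.
under eq_Rintegral do rewrite raddfD.
under [X in Complex _ X]eq_Rintegral do rewrite raddfD.
by rewrite !RintegralD.
Qed.

Lemma cintegralZ D f (c : R[i]) : measurable D -> cintegrable D f ->
  cintegral D (fun x => c * f x) = c * cintegral D f.
Proof.
move=> mD [fr fi]; rewrite /cintegral.
have iZ (r : R) (h : R -> R) : mu.-integrable D (EFin \o h) ->
    mu.-integrable D (EFin \o (fun x => r * h x)).
  by move=> ih; apply: (integrableZl _ r ih).
apply: complex_eq; rewrite ?ReM ?ImM /=.
  under eq_Rintegral do rewrite ReM.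
  by rewrite RintegralB ?RintegralZl//; exact: iZ.
under eq_Rintegral do rewrite ImM.
by rewrite RintegralD ?RintegralZl//; exact: iZ.
Qed.

Lemma cintegral_sum D (I : Type) (r : seq I) (F : I -> R -> R[i]) :
  measurable D -> (forall i, cintegrable D (F i)) ->
  cintegral D (fun x => \sum_(i <- r) F i x) = \sum_(i <- r) cintegral D (F i).
Proof.
move=> mD iF; elim: r => [|i r IHr].
  rewrite big_nil -[RHS](mul0r (cintegral D (fun=> 0))) -cintegralZ//.
    by apply: eq_cintegral => x _; rewrite big_nil mul0r.
  by split; exact: integrable0.
rewrite big_cons -IHr -cintegralD//; last exact: cintegrable_sum.
by apply: eq_cintegral => x _; rewrite big_cons.
Qed.

Lemma ae_eq_cintegral D f g : measurable D -> cmeasurable D f ->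
  cmeasurable D g -> {ae mu, forall x, D x -> f x = g x} ->
  cintegral D f = cintegral D g.
Proof.
move=> mD [fr fi] [gr gi] fg; congr Complex; congr fine;
  apply: ae_eq_integral => //; try exact/measurable_EFinP.
  by move: fg; apply: ae_imply => x /[apply] ->.
by move: fg; apply: ae_imply => x /[apply] ->.
Qed.

Lemma cintegral_shift t D f : measurable D -> cmeasurable D f ->
  cintegral D f = cintegral [set x | D (x + t)] (fun x => f (x + t)).
Proof.
move=> mD [fr fi]; congr Complex; congr fine.
  by rewrite (integral_shift t)//; exact/measurable_EFinP.
by rewrite (integral_shift t)//; exact/measurable_EFinP.
Qed.

Lemma cintegrable_shift t D f : measurable D -> cintegrable D f ->
  cintegrable [set x | D (x + t)] (fun x => f (x + t)).
Proof.
move=> mD [fr fi]; split; first exact: (integrable_shift t mD fr).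
exact: (integrable_shift t mD fi).
Qed.

Lemma cintegral_setU D D' f : measurable D -> measurable D' ->
  cintegrable (D `|` D') f -> [disjoint D & D'] ->
  cintegral (D `|` D') f = cintegral D f + cintegral D' f.
Proof.
move=> mD mD' [fr fi] DD'; apply: complex_eq => /=.
  by rewrite Rintegral_setU.
by rewrite Rintegral_setU.
Qed.

Lemma integrable_setU D D' (f : R -> \bar R) : measurable D -> measurable D' ->
  [disjoint D & D'] ->
  mu.-integrable D f -> mu.-integrable D' f -> mu.-integrable (D `|` D') f.
Proof.
move=> mD mD' DD' /integrableP[mf fi] /integrableP[mf' fi'].
have mfU : measurable_fun (D `|` D') f by exact/measurable_funU.
apply/integrableP; split => //.
rewrite ge0_integral_setU//; first exact: lte_add_pinfty fi fi'.
by apply: measurableT_comp.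
Qed.

Lemma cintegrable_setU D D' f : measurable D -> measurable D' ->
  [disjoint D & D'] ->
  cintegrable D f -> cintegrable D' f -> cintegrable (D `|` D') f.
Proof.
by move=> mD mD' DD' [fr fi] [fr' fi']; split; exact: integrable_setU.
Qed.

End ComplexIntegral.

(** * Periodization *)

Section Cells.
Context {R : realType}.
Local Notation mu := (@lebesgue_measure R).
Variables (a : R) (a_gt0 : 0 < a).

Lemma itvco_cons (c : R) N :
  `[c, c + N.+1%:R * a[%classic =
  `[c, c + a[%classic `|` `[c + a, (c + a) + N%:R * a[%classic.
Proof.
have Na : 0 <= N%:R * a by rewrite mulr_ge0// ltW.
rewrite (_ : c + N.+1%:R * a = (c + a) + N%:R * a); last by rewrite -natr1; ring.
move: (N%:R * a) Na => n n0; have a0 := a_gt0.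
apply/seteqP; split=> x /=; rewrite !in_itv/=.
  by move=> /andP[cx xN]; case: (ltP x (c + a)) => h; [left|right]; rewrite ?cx ?h ?xN.
by case=> /andP[h1 h2]; apply/andP; split; lra.
Qed.

Lemma itvco_cons_disj (c d : R) :
  [disjoint `[c, c + a[%classic & `[c + a, d[%classic].
Proof.
apply/disj_setPS => x /=; rewrite !in_itv/= => -[/andP[_ h] /andP[h' _]].
by move: h; rewrite ltNge h'.
Qed.

Lemma itvco_shift (c : R) :
  [set x : R | `[c, c + a[%classic (x + c)] = `[0, a[%classic.
Proof. by rewrite preshift_itvco subrr addrAC subrr add0r. Qed.

Lemma ge0_integral_cells (c : R) N (f : R -> \bar R) :
  measurable_fun setT f -> (forall x, (0 <= f x)%E) ->
  (\int[mu]_(x in `[c, (c + N%:R * a)%R[) f x =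
   \sum_(m < N) \int[mu]_(x in `[0%R, a[) f (x + (c + m%:R * a))%R)%E.
Proof.
move=> mf f0; elim: N c => [|N IHN] c.
  by rewrite big_ord0 mul0r addr0 set_itvco0 integral_set0.
rewrite itvco_cons ge0_integral_setU//; last 2 first.
- exact: measurable_funTS.
- exact: itvco_cons_disj.
rewrite big_ord_recl/= mul0r addr0; congr (_ + _)%E.
  by rewrite (ge0_integral_shift c)// ?itvco_shift//; exact: measurable_funTS.
rewrite IHN; apply: eq_bigr => i _; apply: eq_integral => x _; congr f.
by rewrite /bump/= natrD; ring.
Qed.

Lemma cintegrable_cell (c : R) N (f : R -> R[i]) (m : 'I_N) :
  cintegrable `[c, c + N%:R * a[ f ->
  cintegrable `[0, a[ (fun x => f (x + (c + m%:R * a))).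
Proof.
move=> fi; rewrite -(itvco_shift (c + m%:R * a)).
apply: cintegrable_shift => //; move: fi; apply: cintegrableS => //.
move=> x /=; rewrite !in_itv/= => /andP[h1 h2]; apply/andP; split.
  by rewrite (le_trans _ h1)// lerDl mulr_ge0// ltW.
rewrite (lt_le_trans h2)// -addrA lerD2l.
by rewrite -{2}(mul1r a) -mulrDl natr1 ler_pM2r// ler_nat.
Qed.

Lemma cintegral_cells (c : R) N (f : R -> R[i]) :
  cintegrable `[c, c + N%:R * a[ f ->
  cintegral `[c, c + N%:R * a[ f =
  \sum_(m < N) cintegral `[0, a[ (fun x => f (x + (c + m%:R * a))).
Proof.
elim: N c => [|N IHN] c fi.
  rewrite big_ord0 mul0r addr0 set_itvco0; apply: complex_eq => /=;
    exact: Rintegral_set0.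
move: (fi); rewrite itvco_cons => fi'.
rewrite cintegral_setU//; last exact: itvco_cons_disj.
rewrite big_ord_recl/= mul0r addr0; congr (_ + _).
  rewrite (cintegral_shift c)// ?itvco_shift//.
  by apply: cintegrable_cmeasurable; move: fi'; apply: cintegrableS => //;
    exact: measurableU.
rewrite IHN; last first.
  by move: fi'; apply: cintegrableS => //; exact: measurableU.
apply: eq_bigr => i _; apply: eq_cintegral => x _; congr f.
by rewrite /bump/= natrD; ring.
Qed.

Definition fpart (x : R) : R := x - (Num.floor (x / a))%:~R * a.

Lemma fpart_itv x : 0 <= fpart x < a.
Proof.
rewrite /fpart subr_ge0 -ler_pdivlMr// floor_le ltrBlDr.
rewrite -[X in X + _ * _]mul1r -mulrDl -ltr_pdivrMr// addrC.
by have := floorD1_gt (x / a); rewrite intrD.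
Qed.

Lemma fpartD x (n : int) : fpart (x + n%:~R * a) = fpart x.
Proof.
rewrite /fpart mulrDl mulfK ?gt_eqF// floorDrz ?intr_int// intrKfloor intrD.
by ring.
Qed.

Lemma fpart_id x : 0 <= x < a -> fpart x = x.
Proof.
move=> /andP[x0 xa]; rewrite /fpart (_ : Num.floor _ = 0) ?mul0r ?subr0//.
apply/eqP; rewrite floor_eq; apply/andP; split; first by rewrite divr_ge0// ltW.
by rewrite ltr_pdivrMr// mul1r.
Qed.

Lemma measurable_fpart : measurable_fun setT fpart.
Proof.
apply: measurable_funB => //; apply: measurable_funM => //.
apply: nondecreasing_measurable => // x y xy.
by rewrite ler_int; apply: le_floor; rewrite ler_pM2r// invr_gt0.
Qed.

Section Periodize.
Variable M : nat.

(* Since [M.*2] nodes above [x] are kept, they exhaust the class of [x] modulo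
   [a] inside the window [-Ma, Ma), whose functions [periodize] is meant for. *)
Definition node (m : nat) (x : R) : R := fpart x + (m%:R - M%:R) * a.

Definition periodize (V : nmodType) (g : R -> V) (x : R) : V :=
  \sum_(m < M.*2) g (node m x).

Lemma node_shift m x : exists n : int, node m x = x + n%:~R * a.
Proof.
exists (m%:Z - M%:Z - Num.floor (x / a)); rewrite /node /fpart !intrD !rmorphN /=.
by ring.
Qed.

Lemma periodizeD (V : nmodType) (g : R -> V) x (n : int) :
  periodize g (x + n%:~R * a) = periodize g x.
Proof. by apply: eq_bigr => m _; rewrite /node fpartD. Qed.

Lemma periodize_itv (V : nmodType) (g : R -> V) x : 0 <= x < a ->
  periodize g x = \sum_(m < M.*2) g (x + (- (M%:R * a) + m%:R * a)).
Proof.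
move=> x0a; apply: eq_bigr => m _; rewrite /node fpart_id//; congr g; ring.
Qed.

(** A point of the window is one of its own nodes: its index [m] is the number of its cell, counted
    from the left end of the window, that is [Num.floor (x / a) + M]. *)
Lemma node_window x : - (M%:R * a) <= x < M%:R * a ->
  exists m : 'I_M.*2, forall k : 'I_M.*2,
    node k x = x + (k%:R - m%:R) * a.
Proof.
move=> /andP[xl xr].
have fl : - M%:Z <= Num.floor (x / a) < M%:Z.
  rewrite floor_ge_int ?floor_lt_int ?ler_pdivlMr ?ltr_pdivrMr//.
  by rewrite rmorphN/= mulNr xl xr.
have fl0 : 0 <= Num.floor (x / a) + M%:Z by lia.
have lt2M : (absz (Num.floor (x / a) + M%:Z)%R < M.*2)%N by lia.
exists (Ordinal lt2M) => k; rewrite /node /fpart /=.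
have -> : (absz (Num.floor (x / a) + M%:Z))%:R = (Num.floor (x / a))%:~R + M%:R :> R.
  by rewrite pmulrn gez0_abs// intrD.
by ring.
Qed.

Lemma measurable_node m : measurable_fun setT (node m).
Proof. by apply: measurable_funD => //; exact: measurable_fpart. Qed.

Lemma cmeasurable_periodize (g : R -> R[i]) :
  cmeasurable setT g -> cmeasurable setT (periodize g).
Proof.
move=> [gr gi]; apply: cmeasurable_sum => m; split.
  exact: measurableT_comp gr (measurable_node m).
exact: measurableT_comp gi (measurable_node m).
Qed.

Let window : `[- (M%:R * a), M%:R * a[%classic =
  `[- (M%:R * a), - (M%:R * a) + M.*2%:R * a[%classic.
Proof. by rewrite -addnn natrD mulrDl addKr. Qed.

Lemma cintegrable_periodize (g : R -> R[i]) :
  cintegrable `[- (M%:R * a), M%:R * a[ g -> cintegrable `[0, a[ (periodize g).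
Proof.
rewrite window => gi.
apply: (@eq_cintegrable _ _
  (fun x => \sum_(m < M.*2) g (x + (- (M%:R * a) + m%:R * a)))) => //.
  by move=> x; rewrite inE/= in_itv/= => x0a; rewrite periodize_itv.
by apply: cintegrable_sum => // m; exact: cintegrable_cell gi.
Qed.

(** The unfolding step of Poisson summation: the window is cut into [M.*2] cells, one for each
    node. *)
Lemma cintegral_periodize (g : R -> R[i]) :
  cintegrable `[- (M%:R * a), M%:R * a[ g ->
  cintegral `[0, a[ (periodize g) = cintegral `[- (M%:R * a), M%:R * a[ g.
Proof.
rewrite window => gi; rewrite cintegral_cells// -cintegral_sum//.
  by apply: eq_cintegral => x; rewrite inE/= in_itv/= => x0a; rewrite periodize_itv.
by move=> m; exact: cintegrable_cell gi.
Qed.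

Lemma ge0_integral_window (f : R -> \bar R) : measurable_fun setT f ->
  (forall x, (0 <= f x)%E) ->
  (\int[mu]_(x in `[(- (M%:R * a))%R, (M%:R * a)%R[) f x =
   \sum_(m < M.*2) \int[mu]_(x in `[0%R, a[) f (node m x))%E.
Proof.
move=> mf f0; rewrite window ge0_integral_cells//; apply: eq_bigr => m _.
apply: eq_integral => x; rewrite inE/= in_itv/= => x0a.
by rewrite /node fpart_id//; congr f; ring.
Qed.

End Periodize.

Lemma itvco_split (x y z : R) : x <= y <= z ->
  `[x, z[%classic = `[x, y[%classic `|` `[y, z[%classic /\
  [disjoint `[x, y[%classic & `[y, z[%classic].
Proof.
move=> /andP[xy yz]; split; last first.
  apply/disj_setPS => u /=; rewrite !in_itv/= => -[/andP[_ h] /andP[h' _]].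
  by move: h; rewrite ltNge h'.
apply/seteqP; split=> u /=; rewrite !in_itv/=.
  by move=> /andP[cx xN]; case: (ltP u y) => h; [left|right]; rewrite ?cx ?h ?xN.
by case=> /andP[h1 h2]; apply/andP; split; lra.
Qed.

(** * Integrals of periodic functions over one period *)

Section PeriodShift.
Variable g : R -> R[i].
Hypothesis gper : forall x (n : int), g (x + n%:~R * a) = g x.
Hypothesis gi : cintegrable `[0, a[ g.

Let gNa x : g (x + - a) = g x.
Proof. by rewrite -(gper x (- 1)); congr g; rewrite mulN1r. Qed.

Let g_fpart t x : g (x + t) = g (x + fpart t).
Proof.
rewrite -(gper (x + fpart t) (Num.floor (t / a))); congr g.
by rewrite /fpart; ring.
Qed.

Let shifted_cell (r : R) :
  [set x : R | `[0, r[%classic (x + - a)] = `[a, a + r[%classic.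
Proof. by rewrite preshift_itvco opprK add0r addrC. Qed.

Let sub_integrable r : 0 <= r < a ->
  [/\ cintegrable `[0, r[ g, cintegrable `[r, a[ g & cintegrable `[a, a + r[ g].
Proof.
move=> /andP[r0 ra].
have [E _] := @itvco_split 0 r a ltac:(by rewrite r0 ltW).
have i1 : cintegrable `[0, r[ g.
  by move: gi; apply: cintegrableS => //; rewrite E; exact: subsetUl.
split => //.
  by move: gi; apply: cintegrableS => //; rewrite E; exact: subsetUr.
rewrite -shifted_cell; apply: (@eq_cintegrable _ _ (fun x => g (x + - a))).
- by rewrite shifted_cell.
- by move=> x _; exact: gNa.
- exact: cintegrable_shift.
Qed.

Let window_split r : 0 <= r < a ->
  `[r, a + r[%classic = `[r, a[%classic `|` `[a, a + r[%classic /\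
  [disjoint `[r, a[%classic & `[a, a + r[%classic].
Proof. by move=> /andP[r0 ra]; apply: itvco_split; rewrite ltW// lerDl. Qed.

Let window_integrable r : 0 <= r < a -> cintegrable `[r, a + r[ g.
Proof.
move=> ra; have [_ i2 i3] := sub_integrable ra.
by have [-> D] := window_split ra; exact: cintegrable_setU.
Qed.

Lemma cintegrable_period_shift t : cintegrable `[0, a[ (fun x => g (x + t)).
Proof.
rewrite (_ : `[0, a[%classic =
    [set x : R | `[fpart t, a + fpart t[%classic (x + fpart t)]).
  apply: (@eq_cintegrable _ _ (fun x => g (x + fpart t))).
  - by rewrite preshift_itvco.
  - by move=> x _; rewrite -g_fpart.
  - by apply: cintegrable_shift => //; apply: window_integrable; exact: fpart_itv.
by rewrite preshift_itvco subrr addrK.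
Qed.

(** Only the remainder of [t] modulo [a] matters. The part of the shifted cell lying beyond [a] is
    moved back by one period and fills the gap left next to 0. *)
Lemma cintegral_period_shift t :
  cintegral `[0, a[ (fun x => g (x + t)) = cintegral `[0, a[ g.
Proof.
have r_itv := fpart_itv t; have /andP[r0 ra] := r_itv.
have [i1 i2 i3] := sub_integrable r_itv; have [E2 D2] := window_split r_itv.
transitivity (cintegral `[fpart t, a + fpart t[ g).
  rewrite [RHS](cintegral_shift (fpart t))//; last first.
    by apply: cintegrable_cmeasurable; exact: window_integrable.
  rewrite preshift_itvco subrr addrK.
  by apply: eq_cintegral => x _; exact: g_fpart.
have [E1 D1] := @itvco_split 0 (fpart t) a ltac:(by rewrite r0 ltW).
rewrite E1 E2 !cintegral_setU//; try by [rewrite -E1|exact: cintegrable_setU].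
rewrite addrC; congr (_ + _).
rewrite [RHS](cintegral_shift (- a))//; last exact: cintegrable_cmeasurable.
by rewrite shifted_cell; apply: eq_cintegral => x _; rewrite gNa.
Qed.

End PeriodShift.

End Cells.

(** * Uniqueness of Fourier coefficients *)

Section FourierUniqueness.
Context {R : realType}.
Local Notation mu := (@lebesgue_measure R).

Lemma bernoulli (y : R) N : -1 <= y -> 1 + N%:R * y <= (1 + y) ^+ N.
Proof.
move=> y1; elim: N => [|N IHN]; first by rewrite mul0r addr0 expr0.
rewrite exprSr; apply: le_trans (_ : (1 + N%:R * y) * (1 + y) <= _).
  have N0 : 0 <= N%:R :> R by [].
  rewrite -natr1; nra.
by apply: ler_wpM2r => //; lra.
Qed.

(** The threshold is 1/2 because Bernoulli's inequality compares these powers with [2 ^ n * s ^+ n],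
    which is [(2 * s) ^+ n]. The same polynomials occur in elementary proofs of the
    Stone-Weierstrass theorem. *)
Lemma cvg_soft_indicator (s : R) : 0 <= s <= 1 -> s != 2^-1 ->
  (1 - s ^+ n) ^+ (2 ^ n) @[n --> \oo] --> (if s < 2^-1 then 1 else 0 : R).
Proof.
move=> /andP[s0 s1] sn2.
have sn n : 0 <= s ^+ n <= 1 by rewrite exprn_ge0//= exprn_ile1.
have pow n : (2 ^ n)%:R * s ^+ n = (2 * s) ^+ n by rewrite natrX exprMn.
case: ltP => s2.
  apply: (@squeeze_cvgr _ _ _ _ (fun n => 1 - (2 * s) ^+ n) (fun=> 1)).
  - apply: nearW => n; have /andP[sn0 sn1] := sn n; apply/andP; split.
      rewrite -pow -mulrN; apply: le_trans (bernoulli _ _) _ => //.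
      by rewrite lerN2.
    by apply: exprn_ile1; lra.
  - rewrite -[X in _ --> X]subr0; apply: cvgB; first exact: cvg_cst.
    by apply: cvg_expr; rewrite ger0_norm; lra.
  - exact: cvg_cst.
have {sn2}s2 : 2^-1 < s by rewrite lt_neqAle eq_sym sn2.
apply: (@squeeze_cvgr _ _ _ _ (fun=> 0) (fun n => (2 * s)^-1 ^+ n)).
- apply: nearW => n; have /andP[sn0 sn1] := sn n; apply/andP; split.
    by apply: exprn_ge0; lra.
  have pos : 0 < (2 * s) ^+ n by apply: exprn_gt0; lra.
  rewrite exprVn -[leRHS]mul1r ler_pdivlMr//.
  (* The extra factor is at least [(2 * s) ^+ n] by Bernoulli, while the full product is a power of
     [1 - s ^+ n * s ^+ n], hence at most 1. *)
  apply: le_trans (_ : (1 - s ^+ n) ^+ (2 ^ n) * (1 + s ^+ n) ^+ (2 ^ n) <= _).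
    apply: ler_wpM2l; first by apply: exprn_ge0; lra.
    rewrite -pow; apply: le_trans (bernoulli _ _); last by lra.
    by rewrite lerDr.
  rewrite -exprMn; apply: exprn_ile1; nra.
- exact: cvg_cst.
- apply: cvg_expr; rewrite ger0_norm ?invr_ge0; last by lra.
  by rewrite invf_lt1; lra.
Qed.

Variables (a : R) (a_gt0 : 0 < a).

Lemma ae_neq (c : R) : {ae mu, forall x, x != c}.
Proof.
exists [set c]; split; [exact: measurable_set1|exact: lebesgue_measure_set1|].
by move=> x /= /negP; rewrite negbK => /eqP.
Qed.

(** Lebesgue differentiation: almost everywhere [f x] is the derivative of the primitive of [f], and
    that primitive vanishes on (0, a). Extending [r] by 0 lets the primitive start at minus
    infinity; the endpoint 0 is discarded because the primitive must vanish on a whole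
    neighbourhood. *)
Lemma primitive_eq0_ae (r : R -> R) : mu.-integrable `[0, a[ (EFin \o r) ->
  (forall b, 0 < b < a -> \int[mu]_(x in `]0, b[) r x = 0) ->
  {ae mu, forall x, 0 <= x < a -> r x = 0}.
Proof.
move=> ri r0.
pose f := r \_ (`[0, a[%classic : set R).
have fi : mu.-integrable setT (EFin \o f).
  by rewrite -restrict_EFin; apply/integrable_restrict => //; rewrite setTI.
have fiD (D : set R) : measurable D -> mu.-integrable D (EFin \o f).
  by move=> mD; apply: integrableS fi.
have := @FTC1Ny _ f (fun y => fiD _ (measurable_itv _))
  (integrable_locally (measurable_itv _) ri).
move=> /(ae_imply2 _ (ae_neq 0)); apply => x x_neq0 [dF F'x] /andP[x0 xa].
have {x_neq0}x0 : 0 < x by rewrite lt_neqAle eq_sym x_neq0.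
have fx : f x = r x by rewrite /f patchE mem_set//= in_itv/= ltW.
rewrite -fx -F'x -(derive1_cst (0 : R) x) !derive1E.
apply: near_eq_derive.
have xin : x \in `]0, a[ by rewrite in_itv/= x0.
near=> b.
have /andP[b0 ba] : 0 < b < a.
  by have : b \in `]0, a[ by near: b; exact: near_in_itvoo; rewrite in_itv.
rewrite /cst -(r0 b); last by rewrite b0.
rewrite /f -Rintegral_mkcondr.
have -> : `]-oo, b] `&` `[0, a[ = `[0, b]%classic :> set R.
  apply/seteqP; split => y /=; rewrite !in_itv/=.
    by move=> [yb /andP[y0 ya]]; rewrite y0.
  by move=> /andP[y0 yb]; split => //; rewrite y0 (le_lt_trans yb).
have sub : `[0, b] `<=` `[0, a[%classic.
  by move=> y /=; rewrite !in_itv/= => /andP[-> yb]; rewrite (le_lt_trans yb).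
rewrite /Rintegral integral_itv_bndoo//.
have : mu.-integrable `[0, b] (EFin \o r) by apply: integrableS ri.
move=> /measurable_int; apply: measurable_funS => //.
exact: subset_itv_oo_cc.
Unshelve. all: by end_near. Qed.

(* Stable under multiplication by a-periodic characters, hence by polynomials in
   [arc b], which on [0, a) is < 1/2 exactly on (0, b) (up to endpoints): the
   polynomials [(1 - arc b x ^+ n) ^+ (2 ^ n)] tend boundedly to the indicator
   of (0, b). *)
Definition fourier_null (u : R -> R[i]) :=
  cintegrable `[0, a[ u /\
  forall k : int, cintegral `[0, a[ (fun x => u x * expi (k%:~R / a) x) = 0.

Lemma fourier_nullD u v : fourier_null u -> fourier_null v ->
  fourier_null (fun x => u x + v x).
Proof.
move=> [ui u0] [vi v0]; split; first exact: cintegrableD.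
move=> k; under eq_cintegral do rewrite mulrDl.
rewrite cintegralD ?u0 ?v0 ?addr0//; exact: cintegrableM_expi.
Qed.

Lemma fourier_nullZ (c : R[i]) u : fourier_null u ->
  fourier_null (fun x => c * u x).
Proof.
move=> [ui u0]; split; first exact: cintegrableZ.
move=> k; under eq_cintegral do rewrite -mulrA.
rewrite cintegralZ ?u0 ?mulr0//; exact: cintegrableM_expi.
Qed.

Lemma fourier_nullM_expi (k : int) u : fourier_null u ->
  fourier_null (fun x => u x * expi (k%:~R / a) x).
Proof.
move=> [ui u0]; split; first exact: cintegrableM_expi.
move=> l; rewrite -(u0 (k + l)); apply: eq_cintegral => x _.
by rewrite -mulrA -expi_addl -mulrDl intrD.
Qed.

Lemma eq_fourier_null u v : u =1 v -> fourier_null u -> fourier_null v.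
Proof. by move=> /funext ->. Qed.

(** Each sine changes sign when [x] increases by [a], so their product has period [a]. For [x] and
    [b] in (0, a) the first sine is positive and the second has the sign of [b - x]. *)
Definition arc (b x : R) : R :=
  2^-1 - 2^-1 * (sin (pi * x / a) * sin (pi * (b - x) / a)).

(** With [h = pi * x / a] and [t = pi * b / a], the product [sin h * sin (t - h)] equals
    [(cos (2 * h - t) - cos t) / 2]. Splitting the first cosine into two conjugate characters turns
    the coefficient 1/4 into 1/8. *)
Lemma arcE b x : (arc b x)%:C%C =
  - ((8^-1)%:C%C * expi (- (2 * a)^-1) b) * expi (1%:~R / a) x +
  (- ((8^-1)%:C%C * expi ((2 * a)^-1) b) * expi ((- 1)%:~R / a) x +
  ((2^-1 + 4^-1 * cos (pi * b / a))%:C%C)) :> R[i].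
Proof.
pose h := pi * x / a; pose t := pi * b / a.
have a0 : a != 0 by rewrite gt_eqF.
have -> : arc b x = 2^-1 - 2^-1 * (sin h * sin (t + - h)).
  by rewrite /arc; congr (_ - _ * (_ * sin _)); rewrite /h /t; field.
have e1 : expi (1%:~R / a) x = Complex (cos (h + h)) (sin (h + h)).
  have -> : h + h = 2 * pi * (1%:~R / a) * x by rewrite /h mulr1z; field.
  by [].
have e2 : expi ((- 1)%:~R / a) x = (Complex (cos (h + h)) (sin (h + h)))^*.
  by rewrite -e1 -expiN -mulNr mulrNz.
have e3 : expi ((2 * a)^-1) b = Complex (cos t) (sin t).
  by rewrite /expi (_ : 2 * pi * (2 * a)^-1 * b = t)// /t; field.
have e4 : expi (- (2 * a)^-1) b = (Complex (cos t) (sin t))^* by rewrite -e3 expiN.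
rewrite e1 e2 e3 e4 !sinD !cosD !sinN !cosN.
have cs : cos h * cos h = 1 - sin h * sin h.
  by rewrite -(cos2Dsin2 h) !expr2 addrK.
have cst : cos h * cos h * cos t = (1 - sin h * sin h) * cos t by rewrite cs.
apply: complex_eq; rewrite !(raddfD, raddfN, ReM, ImM, Re_conj, Im_conj)/=; lra.
Qed.

Lemma arc_range b x : 0 <= arc b x <= 1.
Proof.
have : `|sin (pi * x / a) * sin (pi * (b - x) / a)| <= 1.
  by rewrite normrM mulr_ile1// ler_norml sin_geN1 sin_le1.
by rewrite ler_norml /arc => /andP[h1 h2]; apply/andP; split; lra.
Qed.

Lemma arc_lt b x : 0 < b < a -> 0 < x < a -> x != b ->
  arc b x != 2^-1 /\ (arc b x < 2^-1) = (x < b).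
Proof.
move=> /andP[b0 ba] /andP[x0 xa] xb.
have sx : 0 < sin (pi * x / a).
  apply: sin_gt0_pi; rewrite divr_gt0 ?mulr_gt0 ?pi_gt0//=.
  by rewrite ltr_pdivrMr// ltr_pM2l ?pi_gt0.
rewrite /arc; case: (ltP x b) => h.
  have sbx : 0 < sin (pi * (b - x) / a).
    apply: sin_gt0_pi; rewrite divr_gt0 ?mulr_gt0 ?pi_gt0 ?subr_gt0//=.
    by rewrite ltr_pdivrMr// ltr_pM2l ?pi_gt0//; lra.
  have := mulr_gt0 sx sbx => p0.
  by split; [apply/negP => /eqP; lra|apply/idP; lra].
have {}h : b < x by rewrite lt_neqAle eq_sym xb.
have sbx : 0 < sin (- (pi * (b - x) / a)).
  rewrite -mulNr -mulrN opprB.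
  apply: sin_gt0_pi; rewrite divr_gt0 ?mulr_gt0 ?pi_gt0 ?subr_gt0//=.
  by rewrite ltr_pdivrMr// ltr_pM2l ?pi_gt0//; lra.
rewrite sinN in sbx.
have := mulr_gt0 sx sbx; rewrite mulrN => p0.
split; first by apply/negP => /eqP; lra.
by apply/negbTE; rewrite -leNgt; lra.
Qed.

Lemma fourier_null_poly b (q : {poly R}) h : fourier_null h ->
  fourier_null (fun x => h x * (q.[arc b x])%:C%C).
Proof.
move=> h0; elim/poly_ind: q => [|q c IHq].
  apply: eq_fourier_null (fourier_nullZ 0 h0) => x.
  by rewrite horner0 mul0r mulr0.
set c1 := - ((8^-1)%:C%C * expi (- (2 * a)^-1) b) : R[i].
set c2 := - ((8^-1)%:C%C * expi ((2 * a)^-1) b) : R[i].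
set c3 := (2^-1 + 4^-1 * cos (pi * b / a))%:C%C : R[i].
apply: eq_fourier_null (fourier_nullD (fourier_nullZ c1 (fourier_nullM_expi 1 IHq))
  (fourier_nullD (fourier_nullZ c2 (fourier_nullM_expi (-1) IHq))
  (fourier_nullD (fourier_nullZ c3 IHq) (fourier_nullZ c%:C%C h0)))) => x /=.
rewrite hornerMXaddC rmorphD rmorphM /= arcE -/c1 -/c2 -/c3.
by ring.
Qed.

Lemma fourier_uniqueness h : fourier_null h ->
  {ae mu, forall x, 0 <= x < a -> h x = 0}.
Proof.
move=> h0; have [[hr hi] _] := h0.
pose phi b n x := (1 - arc b x ^+ n) ^+ (2 ^ n).
have phi_null b n : cintegral `[0, a[ (fun x => h x * (phi b n x)%:C%C) = 0.
  have [_ /(_ 0) E] := @fourier_null_poly b ((1 - 'X^n) ^+ (2 ^ n)) h h0.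
  rewrite -[RHS]E.
  by apply: eq_cintegral => x _; rewrite !hornerE expi0l mulr1.
have phi_range b n x : 0 <= phi b n x <= 1.
  have /andP[s0 s1] := arc_range b x.
  have sn0 : 0 <= arc b x ^+ n by exact: exprn_ge0.
  have sn1 : arc b x ^+ n <= 1 by exact: exprn_ile1.
  by rewrite exprn_ge0 ?exprn_ile1//; lra.
(* The weights [phi] are real, so the vanishing integrals split into real and imaginary parts and
   [key] serves for both. Dominated convergence with majorant the absolute value of [r] gives
   integral 0 over every (0, b). *)
have key (r : R -> R) : mu.-integrable `[0, a[ (EFin \o r) ->
    (forall b n, mu.-integrable `[0, a[ (EFin \o (fun x => r x * phi b n x))) ->
    (forall b n, \int[mu]_(x in `[0, a[) (r x * phi b n x) = 0) ->
    {ae mu, forall x, 0 <= x < a -> r x = 0}.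
  move=> ri rphii rphi0; apply: primitive_eq0_ae => // b /andP[b0 ba].
  have sub : `]0, b[ `<=` `[0, a[%classic.
    by move=> y /=; rewrite !in_itv/= => /andP[y0 yb]; rewrite ltW// (lt_trans yb).
  have mr : measurable_fun `[0, a[ r by apply/measurable_EFinP; exact: measurable_int ri.
  pose f := r \_ (`]0, b[%classic : set R).
  have fi : mu.-integrable `[0, a[ (EFin \o f).
    rewrite -restrict_EFin; apply/integrable_restrict => //.
    by rewrite (setIidr sub); apply: integrableS ri.
  have [] := @dominated_convergence _ _ R mu `[0, a[%classic (measurable_itv _)
    (fun n x => (r x * phi b n x)%:E) (EFin \o f) (fun x => `|(r x)%:E|%E).
  - by move=> n; exact: (measurable_int _ (rphii b n)).
  - exact: (measurable_int _ fi).
  (* At 0 and at [b] one of the sines in [arc] vanishes, so [arc b x] is exactly 1/2, the value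
     excluded from [cvg_soft_indicator]. *)
  - have := ae_imply2 (fun x h1 h2 => conj h1 h2) (ae_neq 0) (ae_neq b).
    apply: ae_imply => x [xn0 xnb] /=; rewrite in_itv/= => /andP[x0 xa].
    have {xn0}x0 : 0 < x by rewrite lt_neqAle eq_sym xn0.
    have [an2 alt] := @arc_lt b x ltac:(by rewrite b0) ltac:(by rewrite x0) xnb.
    apply: cvg_EFin; first exact: nearW.
    have -> : f x = r x * (if arc b x < 2^-1 then 1 else 0).
      rewrite /f patchE alt; case: ltP => xb.
        by rewrite mem_set ?mulr1//= in_itv/= x0.
      by rewrite memNset ?mulr0//= in_itv/= x0/= ltNge xb.
    by apply: cvgMr; apply: cvg_soft_indicator => //; exact: arc_range.
  - exact: integrable_abse.
  - apply: aeW => x n _; rewrite /= lee_fin normrM ler_piMr//.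
    by have /andP[p0 p1] := phi_range b n x; rewrite ger0_norm.
  move=> _ _ /=; rewrite (_ : (fun n => _) = (fun=> 0%E)); last first.
    apply/funext => n; rewrite -[LHS]fineK; last first.
      by move: (rphii b n); apply: integrable_fin_num.
    by congr (_%:E); exact: rphi0.
  move=> /(cvg_lim (@ereal_hausdorff R)); rewrite lim_cst//.
  move=> f0; rewrite -(setIidr sub) Rintegral_mkcondr.
  rewrite -[RHS]/(fine 0%E) f0 /Rintegral; congr fine.
have phi_int b n : cintegrable `[0, a[ (fun x => h x * (phi b n x)%:C%C).
  have [hi' _] := @fourier_null_poly b ((1 - 'X^n) ^+ (2 ^ n)) h h0.
  by apply: eq_cintegrable hi' => // x _; rewrite !hornerE.
have Re_phi b n x : complex.Re (h x * (phi b n x)%:C%C) = complex.Re (h x) * phi b n x.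
  by rewrite mulrC (complex_realM _ _).1 mulrC.
have Im_phi b n x : complex.Im (h x * (phi b n x)%:C%C) = complex.Im (h x) * phi b n x.
  by rewrite mulrC (complex_realM _ _).2 mulrC.
apply: ae_imply2 (key _ hr _ _) (key _ hi _ _).
- by move=> x h1 h2 x0a; apply: complex_eq; rewrite ?h1 ?h2.
- move=> b n; have [+ _] := phi_int b n.
  by apply: eq_integrable => // x _; rewrite /= Re_phi.
- move=> b n; have /= E := congr1 (@complex.Re _) (phi_null b n).
  by rewrite -[RHS]E; apply: eq_Rintegral => x _; rewrite Re_phi.
- move=> b n; have [_ +] := phi_int b n.
  by apply: eq_integrable => // x _; rewrite /= Im_phi.
- move=> b n; have /= E := congr1 (@complex.Im _) (phi_null b n).
  by rewrite -[RHS]E; apply: eq_Rintegral => x _; rewrite Im_phi.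
Qed.

End FourierUniqueness.

(** * Square-integrable functions *)

Section SquareNorm.
Context {R : realType}.
Implicit Types x y : R[i].

Definition sqn x : R := complex.Re (`|x| ^+ 2).

Lemma sqnE x : sqn x = complex.Re x ^+ 2 + complex.Im x ^+ 2.
Proof. exact: Re_sqr_norm. Qed.

Lemma sqn_ge0 x : 0 <= sqn x.
Proof. by rewrite sqnE addr_ge0// sqr_ge0. Qed.

Lemma sqn0 : sqn 0 = 0.
Proof. by rewrite sqnE /= !expr0n addr0. Qed.

Lemma sqn_eq0 x : sqn x = 0 -> x = 0.
Proof.
rewrite sqnE => /eqP; rewrite paddr_eq0 ?sqr_ge0// !sqrf_eq0.
by move=> /andP[/eqP h1 /eqP h2]; exact: complex_eq.
Qed.

Lemma sqnM x y : sqn (x * y) = sqn x * sqn y.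
Proof. by rewrite !sqnE ReM ImM; ring. Qed.

Lemma sqnN x : sqn (- x) = sqn x.
Proof. by rewrite !sqnE !raddfN /= !sqrrN. Qed.

Lemma sqn_expi (l t : R) : sqn (expi l t) = 1.
Proof. by rewrite sqnE /= cos2Dsin2. Qed.

Lemma sqn_conjM x : complex.Re (x * x^*) = sqn x.
Proof. by rewrite sqnE ReM Re_conj Im_conj; ring. Qed.

Lemma sqnD_le x y : sqn (x + y) <= 2 * sqn x + 2 * sqn y.
Proof.
rewrite !sqnE !raddfD /=.
have := sqr_ge0 (complex.Re x - complex.Re y).
have := sqr_ge0 (complex.Im x - complex.Im y).
nra.
Qed.

(** A crude constant is enough: the bound only serves to show that operators are bounded. *)
Lemma sqn_sum_le (I : Type) (r : seq I) (F : I -> R[i]) :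
  sqn (\sum_(i <- r) F i) <= 2 ^+ size r * \sum_(i <- r) sqn (F i).
Proof.
elim: r => [|i r IHr]; first by rewrite !big_nil sqn0 mulr0.
rewrite !big_cons /= exprS; apply: le_trans (sqnD_le _ _) _.
have p1 : 1 <= 2 ^+ size r :> R by rewrite exprn_ege1// ler1n.
have := sqn_ge0 (F i); nra.
Qed.

(** Pointwise form of the inclusion of L2 in L1 over a set of finite measure. *)
Lemma abs_Re_le_sqn x : `|complex.Re x| <= 1 + sqn x.
Proof.
rewrite sqnE ler_norml; have := sqr_ge0 (complex.Im x).
have := sqr_ge0 (complex.Re x + 1); have := sqr_ge0 (complex.Re x - 1).
by move=> *; apply/andP; split; nra.
Qed.

Lemma abs_Im_le_sqn x : `|complex.Im x| <= 1 + sqn x.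
Proof.
rewrite sqnE ler_norml; have := sqr_ge0 (complex.Re x).
have := sqr_ge0 (complex.Im x + 1); have := sqr_ge0 (complex.Im x - 1).
by move=> *; apply/andP; split; nra.
Qed.

Lemma abs_conjM_le_sqn x y :
  `|complex.Re (x * y^*)| <= sqn x + sqn y /\
  `|complex.Im (x * y^*)| <= sqn x + sqn y.
Proof.
case: x y => [a b] [c d]; rewrite !sqnE ReM ImM Re_conj Im_conj /= !ler_norml.
have := sqr_ge0 (a + c); have := sqr_ge0 (a - c).
have := sqr_ge0 (b + d); have := sqr_ge0 (b - d).
have := sqr_ge0 (a + d); have := sqr_ge0 (a - d).
have := sqr_ge0 (b + c); have := sqr_ge0 (b - c).
by move=> *; split; apply/andP; split; nra.
Qed.

Lemma measurable_sqn (D : set R) (f : R -> R[i]) :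
  cmeasurable D f -> measurable_fun D (fun t : R => sqn (f t)).
Proof.
move=> [fr fi].
rewrite (_ : (fun t : R => _) =
    (fun t : R => complex.Re (f t) ^+ 2 + complex.Im (f t) ^+ 2)); last first.
  by apply/funext => t; rewrite sqnE.
by apply: measurable_funD; exact: measurable_funX.
Qed.

End SquareNorm.

(** * Square-integrable functions on Omega and their extension by zero *)

Section L2Space.
Context {R : realType}.
Local Notation mu := (@lebesgue_measure R).
Variables (Omega : set R).
Hypothesis mOmega : measurable Omega.
Implicit Types f g : vec (L2 Omega).

Lemma L2_integrable_sqn f : dom f ->
  mu.-integrable Omega (EFin \o (fun x => sqn (f x))).
Proof.
move=> [mf fi]; apply/integrableP; split.
  by apply/measurable_EFinP; exact: (@measurable_sqn _ _ f).
apply: le_lt_trans fi; rewrite le_eqVlt; apply/orP; left; apply/eqP.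
by apply: eq_integral => x _; rewrite /= ger0_norm// sqn_ge0.
Qed.

Lemma L2_le f (g : R -> R) : cmeasurable Omega f ->
  mu.-integrable Omega (EFin \o g) ->
  (forall x, Omega x -> sqn (f x) <= g x) -> dom f.
Proof.
move=> mf gi fg; split => //.
have /integrableP[_] : mu.-integrable Omega (EFin \o (fun x => sqn (f x))).
  apply: le_integrable gi => //.
    by apply/measurable_EFinP; exact: (@measurable_sqn _ _ f).
  move=> x Ox; rewrite /= lee_fin ger0_norm ?sqn_ge0//.
  by rewrite (le_trans (fg _ Ox))// ler_norm.
apply: le_lt_trans; rewrite le_eqVlt; apply/orP; left; apply/eqP.
by apply: eq_integral => x _; rewrite /= ger0_norm// sqn_ge0.
Qed.

Lemma L2_lin (c : R[i]) f g : dom f -> dom g -> dom (c *: f + g).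
Proof.
move=> df dg.
apply: (@L2_le _ (fun x => 2 * sqn c * sqn (f x) + 2 * sqn (g x))).
- apply: cmeasurableD; last by case: dg.
  by apply: cmeasurableM; [exact: cmeasurable_cst|case: df].
- rewrite (_ : _ \o _ = (fun x => (2 * sqn c)%:E * (sqn (f x))%:E
      + 2%:E * (sqn (g x))%:E)%E)//.
  by apply: integrableD => //; apply: integrableZl => //; exact: L2_integrable_sqn.
- by move=> x _; apply: le_trans (sqnD_le _ _) _; rewrite sqnM mulrA.
Qed.

Lemma L2_dom0 : dom (0 : vec (L2 Omega)).
Proof.
split; first exact: cmeasurable_cst.
rewrite (@eq_integral _ _ _ _ _ (fun=> 0%E)) ?integral0//.
by move=> x _; congr (_%:E); exact: sqn0.
Qed.

Lemma L2_sum (I : eqType) (s : seq I) (c : I -> R[i]) (F : I -> vec (L2 Omega)) :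
  (forall i, i \in s -> dom (F i)) -> dom (\sum_(i <- s) c i *: F i).
Proof.
elim: s => [|i s IHs] dF; first by rewrite big_nil; exact: L2_dom0.
rewrite big_cons; apply: L2_lin; first by apply: dF; rewrite mem_head.
by apply: IHs => j js; apply: dF; rewrite inE js orbT.
Qed.

Lemma L2_cintegrable f : (mu Omega < +oo)%E -> dom f -> cintegrable Omega f.
Proof.
move=> Ofin df; apply: (@cintegrable_le _ _ _ (fun x => 1 + sqn (f x))) => //.
- by case: df.
- rewrite (_ : _ \o _ = (fun x => 1%:E + (sqn (f x))%:E)%E)//.
  apply: integrableD => //; last exact: L2_integrable_sqn.
  exact: integrable_cst.
- by move=> x _; rewrite abs_Re_le_sqn abs_Im_le_sqn.
Qed.

Lemma L2_cintegrableM f g : dom f -> dom g ->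
  cintegrable Omega (fun x => (f x : R[i]) * (g x : R[i])^*).
Proof.
move=> df dg.
apply: (@cintegrable_le _ _ _ (fun x => sqn (f x) + sqn (g x))) => //.
- by apply: cmeasurableM; [case: df|apply: cmeasurable_conj; case: dg].
- rewrite (_ : _ \o _ = (fun x => (sqn (f x))%:E + (sqn (g x))%:E)%E)//.
  by apply: integrableD => //; exact: L2_integrable_sqn.
- by move=> x _; exact: abs_conjM_le_sqn.
Qed.

(** A representative of an element of [L2 Omega] has arbitrary values off [Omega]; they have to be
    erased before summing over a class modulo [a]. *)
Definition zext (f : R -> R[i]) (x : R) : R[i] := (\1_Omega x)%:C%C * f x.

Lemma zext_in (f : R -> R[i]) x : Omega x -> zext f x = f x.
Proof. by move=> Ox; rewrite /zext indicE mem_set//= mul1r. Qed.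

Lemma zext_out (f : R -> R[i]) x : ~ Omega x -> zext f x = 0.
Proof. by move=> Ox; rewrite /zext indicE memNset//= mul0r. Qed.

Lemma Re_zext (f : R -> R[i]) :
  (fun x => complex.Re (zext f x)) = (fun x => complex.Re (f x)) \_ Omega.
Proof.
apply/funext => x; rewrite patchE; case: ifPn => /asboolP Ox.
  by rewrite zext_in.
by rewrite zext_out.
Qed.

Lemma Im_zext (f : R -> R[i]) :
  (fun x => complex.Im (zext f x)) = (fun x => complex.Im (f x)) \_ Omega.
Proof.
apply/funext => x; rewrite patchE; case: ifPn => /asboolP Ox.
  by rewrite zext_in.
by rewrite zext_out.
Qed.

Lemma cmeasurable_zext (f : R -> R[i]) :
  cmeasurable Omega f -> cmeasurable setT (zext f).
Proof.
by move=> [fr fi]; split; rewrite ?Re_zext ?Im_zext;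
  apply/(measurable_restrictT _ mOmega).
Qed.

Lemma cintegrable_zext (f : R -> R[i]) (D : set R) : measurable D ->
  cintegrable Omega f -> cintegrable D (zext f).
Proof.
move=> mD [fr fi]; apply: (@cintegrableS _ _ setT) => //.
split; rewrite ?Re_zext ?Im_zext -restrict_EFin;
  by apply/integrable_restrict => //; rewrite setTI.
Qed.

Lemma cintegral_zext (f : R -> R[i]) (D : set R) : Omega `<=` D ->
  cintegral D (zext f) = cintegral Omega f.
Proof.
move=> OD; apply: complex_eq => /=.
  by rewrite Re_zext -Rintegral_mkcondr setIidr.
by rewrite Im_zext -Rintegral_mkcondr setIidr.
Qed.

Lemma ge0_integral_zext (f : R -> R[i]) (D : set R) : Omega `<=` D ->
  (\int[mu]_(x in D) (sqn (zext f x))%:E = \int[mu]_(x in Omega) (sqn (f x))%:E)%E.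
Proof.
move=> OD; rewrite -[in RHS](setIidr OD) [RHS]integral_mkcondr.
apply: eq_integral => x _; rewrite patchE; case: ifPn => /asboolP Ox.
  by rewrite zext_in.
by rewrite zext_out// sqn0.
Qed.

End L2Space.

(** * Sheets of a periodic spectrum *)

Section PeriodizeCharacters.
Context {R : realType}.
Local Notation mu := (@lebesgue_measure R).
Variables (a : R) (a_gt0 : 0 < a) (M : nat).
Local Notation P := (periodize a M).

Lemma expi_periodic (k n : int) x :
  expi (k%:~R / a) (x + n%:~R * a) = expi (k%:~R / a) x.
Proof.
rewrite expi_addr (_ : expi _ (n%:~R * a) = expi 1 ((k * n)%:~R)).
  by rewrite expi_int mulr1.
by rewrite /expi intrM; congr (Complex (cos _) (sin _)); field; rewrite gt_eqF.
Qed.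

Lemma periodizeM_periodic (phi g : R -> R[i]) x :
  (forall x (n : int), phi (x + n%:~R * a) = phi x) ->
  P (fun z => g z * phi z) x = P g x * phi x.
Proof.
move=> phiP; rewrite /periodize big_distrl/=; apply: eq_bigr => m _.
by have [n ->] := node_shift a M m x; rewrite phiP.
Qed.

Lemma ae_periodize (V : nmodType) (g g' : R -> V) :
  {ae mu, forall x, g x = g' x} -> {ae mu, forall x, P g x = P g' x}.
Proof.
move=> /(ae_shift_int a); apply: ae_imply => x h; apply: eq_bigr => m _.
by have [n ->] := node_shift a M m x; exact: h.
Qed.

Lemma cintegral_cst_cell : cintegral `[0, a[ (fun=> 1) = a%:C%C.
Proof.
have muI : fine (mu `[0%R, a[) = a.
  by rewrite lebesgue_measure_itv /= lte_fin a_gt0 -EFinB subr0.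
by apply: complex_eq; rewrite /= Rintegral_cst// muI ?mul1r ?mul0r.
Qed.

Lemma mu_cell_fin : (mu `[0%R, a[ < +oo)%E.
Proof. by rewrite lebesgue_measure_itv /= lte_fin a_gt0 /= -EFinB ltry. Qed.

Lemma cintegrable_expi_cell l : cintegrable `[0, a[ (expi l).
Proof.
apply: (@eq_cintegrable _ _ (fun x => 1 * expi l x)) => //.
  by move=> x _; rewrite mul1r.
apply: cintegrableM_expi => //; apply: cintegrable_cst => //.
exact: mu_cell_fin.
Qed.

(* For [k <> 0], translating by half a wavelength changes the sign. *)
Lemma cintegral_expi_cell (k : int) :
  cintegral `[0, a[ (expi (k%:~R / a)) = (k == 0)%:R * a%:C%C.
Proof.
have [->|k0] := eqVneq k 0.
  rewrite mul1r -cintegral_cst_cell; apply: eq_cintegral => x _.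
  by rewrite mulr0z mul0r expi0l.
have kR0 : k%:~R != 0 :> R by rewrite intr_eq0.
pose t := a / (2 * k%:~R).
have et : expi (k%:~R / a) t = -1.
  have -> : expi (k%:~R / a) t = Complex (cos pi) (sin pi).
    rewrite /expi (_ : 2 * pi * _ * _ = pi)// /t; field.
    by rewrite kR0 gt_eqF.
  by rewrite cospi sinpi; apply: complex_eq; rewrite /= ?oppr0.
have := cintegral_period_shift a_gt0 (fun x n => expi_periodic k n x)
  (cintegrable_expi_cell _) t.
under eq_cintegral do rewrite expi_addr et mulrC.
rewrite cintegralZ//; last exact: cintegrable_expi_cell.
rewrite mulN1r mul0r => /eqP; rewrite -subr_eq0 -opprD oppr_eq0.
by rewrite -mulr2n mulrn_eq0/= => /eqP.
Qed.

Lemma periodic_fourier_null (h : R -> R[i]) :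
  (forall x (n : int), h (x + n%:~R * a) = h x) -> fourier_null a h ->
  {ae mu, forall x, h x = 0}.
Proof.
move=> hP /(fourier_uniqueness a_gt0)/(ae_shift_int a).
apply: ae_imply => x /(_ (- Num.floor (x / a))).
by rewrite hP rmorphN /= mulNr -/(fpart a x) fpart_itv// => /(_ isT).
Qed.

End PeriodizeCharacters.

Section PeriodicSpectrum.
Context {R : realType}.
Local Notation mu := (@lebesgue_measure R).
Variables (a : R) (a_gt0 : 0 < a) (M : nat) (Omega : set R).
Hypothesis mOmega : measurable Omega.
Hypothesis OmegaM : Omega `<=` `[- (M%:R * a), M%:R * a[%classic.
Hypothesis Omega1 : mu Omega = 1%E.
Variables (I : finType) (lam : I -> R) (Lambda : set R).
Hypothesis lam_inj : forall i j (k : int), lam i = lam j + k%:~R / a -> i = j.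
Hypothesis LambdaE :
  Lambda = [set x | exists (j : I) (k : int), x = lam j + k%:~R / a].
Hypothesis spec : has_spectrum Omega Lambda.
Local Notation P := (periodize a M).
Local Notation zO := (zext Omega).

Let Omega_fin : (mu Omega < +oo)%E.
Proof. by rewrite Omega1 ltry. Qed.

Lemma Lambda_lam j (k : int) : Lambda (lam j + k%:~R / a).
Proof. by rewrite LambdaE; exists j, k. Qed.

Lemma spectrum_basis :
  orthonormal_basis (H := L2 Omega) Lambda (fun l => expi l : vec (L2 Omega)).
Proof.
move: spec; rewrite /has_spectrum Omega1 /= sqrtr1 invr1.
rewrite (_ : (fun l x => _) = (fun l => expi l))//.
by apply/funext => l; apply/funext => x; rewrite mul1r.
Qed.

Lemma spectrum_dom l : Lambda l -> dom (expi l : vec (L2 Omega)).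
Proof. by case: spectrum_basis => + _ _; apply. Qed.

Lemma spectrum_dotp l m : Lambda l -> Lambda m ->
  cintegral Omega (fun x => expi l x * expi (- m) x) = (l == m)%:R.
Proof.
move=> Ll Lm; case: spectrum_basis => _ /(_ _ _ Ll Lm) + _ => <-.
by apply: eq_cintegral => x _; rewrite expiN.
Qed.

(* The component of [f] along the closed span of the [expi l], [l] in
   [lam j + Z/a], summed in closed form (Poisson summation). *)
Definition sheet (j : I) (f : R -> R[i]) (x : R) : R[i] :=
  a%:C%C * expi (lam j) x * P (fun z => zO f z * expi (- lam j) z) x.

Lemma lam_eq i j (k : int) :
  (lam i + k%:~R / a == lam j) = (i == j) && (k == 0).
Proof.
apply/eqP/andP => [h|[/eqP -> /eqP ->]]; last by rewrite mulr0z mul0r addr0.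
have ij : j = i by apply: (@lam_inj _ _ k); rewrite h.
split; first by rewrite ij.
move: h; rewrite ij => /eqP; rewrite -subr_eq0 addrAC subrr add0r.
by rewrite mulf_eq0 invr_eq0 (gt_eqF a_gt0) orbF intr_eq0.
Qed.

Lemma cintegrable_window (f : R -> R[i]) l : cintegrable Omega f ->
  cintegrable `[- (M%:R * a), M%:R * a[ (fun z => zO f z * expi l z).
Proof.
by move=> fi; apply: cintegrableM_expi => //; exact: cintegrable_zext.
Qed.

Lemma cintegral_window (f : R -> R[i]) l : cintegrable Omega f ->
  cintegral `[- (M%:R * a), M%:R * a[ (fun z => zO f z * expi l z) =
  cintegral Omega (fun z => f z * expi l z).
Proof.
move=> fi; rewrite -(cintegral_zext _ OmegaM).
by apply: eq_cintegral => z _; rewrite /zext mulrA.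
Qed.

(** Core of Poisson summation: after unfolding, a Fourier coefficient of a periodization is a value
    of the Fourier transform of the original function. The periodic character enters the
    periodization freely. *)
Lemma fourier_periodize (f : R -> R[i]) l (k : int) : cintegrable Omega f ->
  cintegral `[0, a[ (fun x => P (fun z => zO f z * expi l z) x
    * expi (k%:~R / a) x) =
  cintegral Omega (fun z => f z * expi (l + k%:~R / a) z).
Proof.
move=> fi; rewrite -cintegral_window// -cintegral_periodize//; last first.
  exact: cintegrable_window.
apply: eq_cintegral => x _; rewrite -periodizeM_periodic//; last first.
  by move=> y n; exact: expi_periodic.
by apply: eq_bigr => m _; rewrite expi_addl mulrA.
Qed.

Lemma sheets_orthogonal i j : {ae mu, forall x,
  P (fun z => zO (expi (lam i)) z * expi (- lam j) z) x = (i == j)%:R * (a^-1)%:C%C}.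
Proof.
pose g z : R[i] := zO (expi (lam i)) z * expi (- lam j) z.
pose c : R[i] := (i == j)%:R * (a^-1)%:C%C.
have lami k : Lambda (lam k).
  by have := Lambda_lam k 0; rewrite mulr0z mul0r addr0.
have ei : cintegrable Omega (expi (lam i)).
  by apply: L2_cintegrable => //; exact: spectrum_dom.
have Pi : cintegrable `[0, a[ (P g).
  by apply: cintegrable_periodize => //; exact: cintegrable_window.
have ci : cintegrable `[0, a[ (fun=> - c).
  by apply: cintegrable_cst => //; exact: mu_cell_fin.
have null : fourier_null a (fun x => P g x - c).
  split; first exact: cintegrableD.
  move=> k; under eq_cintegral do rewrite mulrDl.
  rewrite cintegralD//; last 2 first.
    exact: cintegrableM_expi.
    exact: cintegrableM_expi.
  rewrite cintegralZ//; last exact: cintegrable_expi_cell.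
  rewrite fourier_periodize// cintegral_expi_cell//.
  rewrite (_ : cintegral Omega _ = (lam i + k%:~R / a == lam j)%:R); last first.
    rewrite -spectrum_dotp//; last exact: Lambda_lam.
    by apply: eq_cintegral => x _; rewrite !expi_addl; ring.
  rewrite lam_eq /c; case: (i == j); case: (k == 0);
    rewrite ?(mul0r, mulr0, mul1r, oppr0, addr0)//=.
  by rewrite mulNr -rmorphM mulVf ?gt_eqF// subrr.
have gP x (n : int) : P g (x + n%:~R * a) - c = P g x - c by rewrite periodizeD.
apply: ae_imply (periodic_fourier_null a_gt0 gP null) => x /eqP.
by rewrite subr_eq0 => /eqP.
Qed.

Lemma zext_lin (c : R[i]) (f g : R -> R[i]) x :
  zO (fun z => c * f z + g z) x = c * zO f x + zO g x.
Proof. by rewrite /zext; ring. Qed.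

Lemma sheet_lin j (c : R[i]) (f g : R -> R[i]) x :
  sheet j (fun z => c * f z + g z) x = c * sheet j f x + sheet j g x.
Proof.
rewrite /sheet; set u := a%:C%C * _.
rewrite (_ : P _ x = c * P (fun z => zO f z * expi (- lam j) z) x
   + P (fun z => zO g z * expi (- lam j) z) x); first by ring.
rewrite /periodize mulr_sumr -big_split /=; apply: eq_bigr => m _.
by rewrite zext_lin; ring.
Qed.

Lemma sheet_ae j (f g : R -> R[i]) :
  {ae mu, forall x, Omega x -> f x = g x} ->
  {ae mu, forall x, sheet j f x = sheet j g x}.
Proof.
move=> fg; have : {ae mu, forall x,
    zO f x * expi (- lam j) x = zO g x * expi (- lam j) x}.
  apply: ae_imply fg => x fgx; congr (_ * _).
  have [Ox|Ox] := pselect (Omega x); last by rewrite !zext_out.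
  by rewrite !zext_in// fgx.
move/(ae_periodize a M); apply: ae_imply => x.
by rewrite /sheet => ->.
Qed.

Lemma cmeasurable_sheet j (f : R -> R[i]) :
  cmeasurable Omega f -> cmeasurable setT (sheet j f).
Proof.
move=> mf; apply: cmeasurableM.
  by apply: cmeasurableM; [exact: cmeasurable_cst|exact: cmeasurable_expi].
apply: cmeasurable_periodize => //; apply: cmeasurableM.
  exact: cmeasurable_zext.
exact: cmeasurable_expi.
Qed.

Lemma sheet_quasiperiodic j (f : R -> R[i]) x (n : int) :
  sheet j f (x + n%:~R * a) = expi (lam j) (n%:~R * a) * sheet j f x.
Proof. by rewrite /sheet periodizeD// expi_addr; ring. Qed.

(** The periodic factor [expi (k%:~R / a)] comes out of the periodization and leaves the constant of
    [sheets_orthogonal]. Thus [sheet j] acts on the spectrum as a projection, and the sheet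
    continues the exponential to the whole line. *)
Lemma sheet_expi i j (k : int) : {ae mu, forall x,
  sheet j (expi (lam i + k%:~R / a)) x
    = (i == j)%:R * expi (lam i + k%:~R / a) x}.
Proof.
apply: ae_imply (sheets_orthogonal i j) => x Px.
rewrite /sheet (_ : P _ x = (i == j)%:R * (a^-1)%:C%C * expi (k%:~R / a) x).
  have aV : a%:C%C * (a^-1)%:C%C = 1 :> R[i] by rewrite -rmorphM mulfV ?gt_eqF.
  have [<-|_] := eqVneq i j; last by rewrite !mul0r mulr0.
  rewrite expi_addl -[RHS]mulr1 -aV.
  by move: a%:C%C (a^-1)%:C%C (expi _ _) (expi _ _) => u v e1 e2 /=; ring.
rewrite -Px -periodizeM_periodic; last by move=> y n; exact: expi_periodic.
by apply: eq_bigr => m _; rewrite /zext expi_addl; ring.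
Qed.

Lemma sheet_bound : exists2 K : R, 0 <= K & forall j (f : R -> R[i]) x,
  sqn (sheet j f x) <= K * \sum_(m < M.*2) sqn (zO f (node a M m x)).
Proof.
exists (a ^+ 2 * 2 ^+ size (index_enum 'I_M.*2)).
  by rewrite mulr_ge0 ?sqr_ge0// exprn_ge0.
move=> j f x; rewrite /sheet !sqnM sqn_expi mulr1 -mulrA.
rewrite (_ : sqn a%:C%C = a ^+ 2); last by rewrite sqnE /= expr0n addr0.
rewrite ler_wpM2l ?sqr_ge0//; apply: le_trans (sqn_sum_le _ _) _.
rewrite ler_wpM2l ?exprn_ge0//.
by apply: ler_sum => m _; rewrite sqnM sqn_expi mulr1.
Qed.

Lemma sume_const (N : nat) (c : \bar R) : (0 <= c)%E ->
  (\sum_(n < N) c = N%:R%:E * c)%E.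
Proof.
move=> c0; elim: N => [|N IHN]; first by rewrite big_ord0 mul0e.
by rewrite big_ord_recr /= IHN -natr1 EFinD ge0_muleDl// mul1e.
Qed.

(** The sum over the nodes is periodic, so its integral over the window is [M.*2] times that over
    one cell, and the latter unfolds to the integral of [sqn (zO f x)] over the window. *)
Lemma integral_nodes (f : R -> R[i]) : cmeasurable Omega f ->
  (\int[mu]_(x in Omega) (\sum_(m < M.*2) sqn (zO f (node a M m x)))%:E
   <= (M.*2%:R)%:E * \int[mu]_(x in Omega) (sqn (f x))%:E)%E.
Proof.
move=> mf; pose s x := \sum_(m < M.*2) sqn (zO f (node a M m x)).
have mz : cmeasurable setT (zO f) by exact: cmeasurable_zext.
have msn m : measurable_fun setT (fun x : R => sqn (zO f (node a M m x))).
  exact: measurableT_comp (measurable_sqn mz) (measurable_node a_gt0 M m).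
have ms : measurable_fun setT (EFin \o s).
  by apply/measurable_EFinP; exact: measurable_sum.
have s0 x : 0 <= s x by apply: sumr_ge0 => m _; exact: sqn_ge0.
apply: (@le_trans _ _ (\int[mu]_(x in `[(- (M%:R * a))%R, (M%:R * a)%R[) (s x)%:E)%E).
  apply: ge0_subset_integral => //; first exact: (measurable_funTS ms).
  by move=> x _; rewrite lee_fin; exact: s0.
rewrite -(ge0_integral_zext _ OmegaM).
rewrite (ge0_integral_window a_gt0 M ms)//.
have -> : (\sum_(m < M.*2) \int[mu]_(x in `[0%R, a[) (EFin \o s) (node a M m x)
    = \sum_(m < M.*2) \int[mu]_(x in `[0%R, a[) (s x)%:E)%E.
  apply: eq_bigr => n _; apply: eq_integral => x _ /=; congr (_%:E).
  have [k ->] := node_shift a M n x.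
  exact: (periodizeD a_gt0 M (fun y => sqn (zO f y))).
rewrite sume_const; last by apply: integral_ge0 => x _; rewrite lee_fin s0.
apply: lee_wpmul2l; first by rewrite lee_fin.
rewrite (@ge0_integral_window _ _ a_gt0 M (fun x => (sqn (zO f x))%:E)); last 2 first.
- by apply/measurable_EFinP; exact: measurable_sqn.
- by move=> x; rewrite lee_fin sqn_ge0.
rewrite -ge0_integral_sum//; last 2 first.
- by move=> m; apply/measurable_EFinP; exact: (measurable_funTS (msn m)).
- by move=> m x _; rewrite lee_fin sqn_ge0.
by rewrite le_eqVlt; apply/orP; left; apply/eqP; apply: eq_integral => x _;
  rewrite sumEFin.
Qed.

(** * Completeness: the sheets of a function sum to it on Omega *)

Definition defect (f : R -> R[i]) (x : R) : R[i] := \sum_j sheet j f x - f x.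

Lemma cmeasurable_defect (f : R -> R[i]) :
  cmeasurable Omega f -> cmeasurable Omega (defect f).
Proof.
move=> mf; apply: cmeasurableD.
  apply: (cmeasurableS measurableT) => //.
  by apply: cmeasurable_sum => j; exact: cmeasurable_sheet.
rewrite (_ : (fun x => - f x) = (fun x => -1 * f x)).
  by apply: cmeasurableM => //; exact: cmeasurable_cst.
by apply/funext => x; rewrite mulN1r.
Qed.

(** Boundedness on [L2 Omega] is what carries the vanishing of [defect] from trigonometric
    polynomials to all functions. *)
Lemma defect_bound : exists2 K : R, 0 <= K & forall f : R -> R[i],
  cmeasurable Omega f ->
  (\int[mu]_(x in Omega) (sqn (defect f x))%:E
    <= K%:E * \int[mu]_(x in Omega) (sqn (f x))%:E)%E.
Proof.
have [K K0 hK] := sheet_bound.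
(* The outer 2 separates the sum of sheets from [f], the power of 2 comes from [sqn_sum_le], and
   each of the [#|I|] sheets contributes [K]. Integrating the node sum will cost a further
   [M.*2]. *)
pose L := 2 * (2 ^+ size (index_enum I) * (#|I|%:R * K)).
have L0 : 0 <= L by rewrite !mulr_ge0// exprn_ge0.
exists (L * M.*2%:R + 2); first by rewrite addr_ge0// mulr_ge0.
move=> f mf.
have mz : cmeasurable setT (zO f) by exact: cmeasurable_zext.
pose s x := \sum_(m < M.*2) sqn (zO f (node a M m x)).
have ms : measurable_fun Omega (EFin \o s).
  apply/measurable_EFinP; apply: measurable_funTS; apply: measurable_sum => m.
  exact: measurableT_comp (measurable_sqn mz) (measurable_node a_gt0 M m).
have s0 x : 0 <= s x by apply: sumr_ge0 => m _; exact: sqn_ge0.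
have msf : measurable_fun Omega (EFin \o (fun x : R => sqn (f x))).
  by apply/measurable_EFinP; exact: measurable_sqn.
have pt x : sqn (defect f x) <= L * s x + 2 * sqn (f x).
  apply: le_trans (sqnD_le _ _) _; rewrite sqnN lerD2r /L -!mulrA ler_wpM2l//.
  apply: le_trans (sqn_sum_le _ _) _; rewrite ler_wpM2l ?exprn_ge0//.
  apply: (@le_trans _ _ (\sum_(j : I) K * s x)); first by apply: ler_sum.
  by rewrite sumr_const mulr_natl.
apply: (@le_trans _ _ (\int[mu]_(x in Omega)
    (L%:E * (s x)%:E + 2%:E * (sqn (f x))%:E))%E).
  apply: ge0_le_integral => //.
  - by move=> x _; rewrite lee_fin sqn_ge0.
  - by apply/measurable_EFinP; apply: measurable_sqn; exact: cmeasurable_defect.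
  - by apply: emeasurable_funD; exact: measurable_funeM.
  - by move=> x _; rewrite -!EFinM -EFinD lee_fin.
rewrite ge0_integralD//; last 4 first.
- by move=> x _; rewrite mule_ge0// lee_fin.
- exact: measurable_funeM.
- by move=> x _; rewrite mule_ge0// lee_fin// sqn_ge0.
- exact: measurable_funeM.
rewrite !ge0_integralZl//; last 2 first.
- by move=> x _; rewrite lee_fin sqn_ge0.
- by move=> x _; rewrite lee_fin.
rewrite [(L * _ + 2)%:E]EFinD [leRHS]ge0_muleDl ?lee_fin ?mulr_ge0//.
apply: leeD => //.
rewrite [(L * _)%:E]EFinM -[leRHS]muleA; apply: lee_wpmul2l; first by rewrite lee_fin.
exact: integral_nodes.
Qed.

Lemma defect_lin (c : R[i]) (f g : R -> R[i]) x :
  defect (fun z => c * f z + g z) x = c * defect f x + defect g x.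
Proof.
rewrite /defect (eq_bigr (fun j => c * sheet j f x + sheet j g x)); last first.
  by move=> j _; exact: sheet_lin.
by rewrite big_split /= -mulr_sumr; ring.
Qed.

Lemma defect_expi l : Lambda l -> {ae mu, forall x, defect (expi l) x = 0}.
Proof.
rewrite LambdaE => -[i [k ->]].
have := ae_forall (fun j => sheet_expi i j k); apply: ae_imply => x h.
rewrite /defect (eq_bigr _ (fun j _ => h j)) (bigD1 i)//= eqxx mul1r big1
  ?addr0 ?subrr//.
by move=> j /negbTE ji; rewrite eq_sym ji mul0r.
Qed.

Lemma defect_span (s : seq R) (c : R -> R[i]) : (forall l, l \in s -> Lambda l) ->
  {ae mu, forall x,
    defect ((\sum_(l <- s) c l *: (expi l : vec (L2 Omega))) : vec (L2 Omega)) x = 0}.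
Proof.
elim: s => [|l s IHs] sL.
  apply: aeW => x; rewrite big_nil.
  have := defect_lin (-1) (fun=> 0) (fun=> 0) x.
  rewrite (_ : (fun _ => _) = (fun=> 0)); last first.
    by apply/funext => z; rewrite mulr0 addr0.
  by rewrite mulN1r addNr.
have sL' k : k \in s -> Lambda k by move=> ks; apply: sL; rewrite inE ks orbT.
apply: ae_imply2 (defect_expi (sL l (mem_head _ _))) (IHs sL') => x h1 h2.
rewrite big_cons; set S := \sum_(i <- s) _ in h2 *.
by rewrite [LHS](defect_lin (c l) (expi l) S) h1 h2 mulr0 addr0.
Qed.

Lemma hnorm_lt (f : vec (L2 Omega)) e : dom f -> 0 < e -> hnorm f < e ->
  (\int[mu]_(x in Omega) (sqn (f x))%:E <= (e ^+ 2)%:E)%E.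
Proof.
move=> df e0; rewrite /hnorm -{1}(ger0_norm (ltW e0)) -sqrtr_sqr.
rewrite ltr_sqrt ?exprn_gt0//.
rewrite /= (_ : \int[mu]_(x in Omega) _ = \int[mu]_(x in Omega) sqn (f x)); last first.
  by apply: eq_Rintegral => x _; rewrite sqn_conjM.
have fin : (\int[mu]_(x in Omega) (sqn (f x))%:E)%E \is a fin_num.
  by move: (L2_integrable_sqn df); apply: integrable_fin_num.
by rewrite /Rintegral -lte_fin fineK// => /ltW.
Qed.

(* [f] differs from a trigonometric polynomial over the spectrum by a function
   of small norm, and the bounded operator [defect] kills the former. *)
Lemma sheets_sum (f : vec (L2 Omega)) : dom f ->
  {ae mu, forall x, Omega x -> \sum_j sheet j f x = f x}.
Proof.
move=> df; have [K K0 hK] := defect_bound.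
have mdf : measurable_fun Omega (fun x : R => sqn (defect f x)).
  by apply: measurable_sqn; apply: cmeasurable_defect; case: df.
have int0 : (\int[mu]_(x in Omega) (sqn (defect f x))%:E = 0)%E.
  apply/eqP; rewrite eq_le; apply/andP; split; last first.
    by apply: integral_ge0 => x _; rewrite lee_fin sqn_ge0.
  apply/lee_addgt0Pr => e e0; rewrite add0e.
  (* Chosen so that [K * d ^+ 2] is at most [e]; the added 1 covers the case [K = 0]. *)
  pose d := Num.sqrt (e / (K + 1)).
  have d0 : 0 < d by rewrite sqrtr_gt0 divr_gt0// ltr_wpDl.
  case: spectrum_basis => edom _ /(_ f df d d0)[s [c [sL]]].
  set S := \sum_(i <- s) _ => hlt.
  have dS : dom (f - S).
    rewrite -scaleN1r addrC; apply: L2_lin => //.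
    by apply: L2_sum => // l /sL; exact: edom.
  have -> : (\int[mu]_(x in Omega) (sqn (defect f x))%:E =
      \int[mu]_(x in Omega) (sqn (defect (f - S) x))%:E)%E.
    apply: ae_eq_integral => //.
    - exact/measurable_EFinP.
    - apply/measurable_EFinP; apply: measurable_sqn.
      by apply: cmeasurable_defect; case: dS.
    - apply: ae_imply (defect_span c sL) => x h Ox; congr (sqn _)%:E.
      have := defect_lin (-1) S f x; rewrite h mulr0 add0r => <-.
      congr defect; apply/funext => z.
      by rewrite mulN1r addrC.
  apply: le_trans (hK _ _) _; first by case: dS.
  apply: le_trans (lee_wpmul2l _ (hnorm_lt dS d0 hlt)) _; first by rewrite lee_fin.
  rewrite -EFinM lee_fin sqr_sqrtr; last by rewrite divr_ge0 ?ltW// ltr_wpDl.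
  rewrite mulrCA ger_pMr// ler_pdivrMr ?ltr_wpDl// mul1r; lra.
have h : ae_eq mu Omega (EFin \o (fun x => sqn (defect f x))) (cst 0%E).
  apply/ae_eq_integral_abs => //; first exact/measurable_EFinP.
  rewrite -[RHS]int0; apply: eq_integral => x _.
  by rewrite /= ger0_norm// sqn_ge0.
apply: ae_imply h => x /[apply] -[] /sqn_eq0 /eqP.
by rewrite /defect subr_eq0 => /eqP.
Qed.

(* The indicator of one cell of the window: on it each sheet of the marker is
   [a], so summing the sheets counts them. *)
Definition marker (m : nat) (x : R) : R[i] := if node a M m x == x then 1 else 0.

Lemma marker_dom m : dom (marker m : vec (L2 Omega)).
Proof.
have mb : measurable_fun setT (fun x => node a M m x == x).
  by apply: measurable_fun_eqr => //; exact: measurable_node.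
apply: (@L2_le _ _ mOmega _ (fun=> 1)).
- apply: (cmeasurableS measurableT) => //; split.
    rewrite (_ : (fun x => _) = (fun x => if node a M m x == x then 1 else 0)).
      by apply: measurable_fun_ifT => //; exact: measurable_cst.
    by apply/funext => x; rewrite /marker; case: ifP.
  rewrite (_ : (fun x => _) = (fun=> 0)); first exact: measurable_cst.
  by apply/funext => x; rewrite /marker; case: ifP.
- exact: integrable_cst.
- by move=> x _; rewrite /marker; case: ifP; rewrite ?sqn0// sqnE /= expr0n
    addr0 expr1n.
Qed.

(** Among the nodes of [x] the marker is 1 only at [x] itself, where the characters [expi (lam j)]
    and [expi (- lam j)] cancel. *)
Lemma sheet_marker j (m : 'I_M.*2) x : Omega x -> node a M m x = x ->
  sheet j (marker m) x = a%:C%C.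
Proof.
move=> Ox mx.
have nodek (k : 'I_M.*2) : node a M k x = x + (k%:R - m%:R) * a.
  by rewrite -[X in _ = X + _]mx /node; ring.
have markerk (k : 'I_M.*2) : marker m (node a M k x) = (k == m)%:R.
  rewrite /marker; have [n nE] := node_shift a M k x.
  have -> : node a M m (node a M k x) = x.
    by rewrite {1}/node nE fpartD// -/(node a M m x).
  rewrite nodek -[X in X == _]addr0 (inj_eq (addrI x)) eq_sym mulf_eq0.
  by rewrite (gt_eqF a_gt0) orbF subr_eq0 eqr_nat val_eqE; case: ifP.
rewrite /sheet /periodize (bigD1 m)//= big1 ?addr0; last first.
  by move=> k /negbTE km; rewrite /zext markerk km mulr0 mul0r.
have := markerk m; rewrite mx eqxx => mm.
by rewrite zext_in// mm mul1r -mulrA expi_mulN mulr1.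
Qed.

(** On [Omega] the sheets of the marker of the current cell sum to [#|I|%:R * a], while the marker
    is 1. If these numbers differed, [sheets_sum] would fail at every point of [Omega], which would
    then be null. *)
Lemma card_spectrum : #|I|%:R * a = 1.
Proof.
apply/eqP/negPn/negP => ne1.
have : {ae mu, forall x, forall m : 'I_M.*2,
    Omega x -> \sum_j sheet j (marker m) x = marker m x}.
  by apply: ae_forall => m; exact/sheets_sum/marker_dom.
move=> /(ae_imply (Q := fun x => ~ Omega x)) [].
  move=> x h Ox; have xM : - (M%:R * a) <= x < M%:R * a.
    by have := OmegaM Ox; rewrite /= in_itv.
  have [m mE] := node_window a_gt0 xM.
  have mx : node a M m x = x by rewrite mE subrr mul0r addr0.
  have := h m Ox; rewrite (eq_bigr _ (fun j _ => sheet_marker j Ox mx)).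
  rewrite sumr_const /marker mx eqxx -mulr_natl => /(congr1 (@complex.Re R)).
  rewrite -[#|I|%:R](rmorph_nat (real_complex R)) (complex_realM _ _).1 /=.
  by move/eqP; apply/negP.
move=> A [mA A0 OA]; have : (mu Omega <= mu A)%E.
  by apply: le_measure; rewrite ?inE// => x Ox; apply: OA => /=; exact.
by rewrite Omega1 A0 lee_fin ler10.
Qed.

(** The product of [expi (- lam j)] and [sheet j g] is periodic, so its conjugate moves inside the
    periodization defining [sheet j f]. *)
Lemma sheet_adjoint j (f g : R -> R[i]) x :
  sheet j f x * (sheet j g x)^* =
  a%:C%C * P (fun z => zO f z * (sheet j g z)^*) x.
Proof.
pose c z := expi (- lam j) z * sheet j g z.
have cP y (n : int) : (c (y + n%:~R * a))^* = (c y)^*.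
  rewrite /c sheet_quasiperiodic expi_addr.
  have := expi_mulN (lam j) (n%:~R * a); move: (expi _ _) (expi (- _) _) => u v uv.
  by rewrite -mulrA [v * _]mulrA (mulrC v) uv mul1r.
have cE z : (sheet j g z)^* = expi (- lam j) z * (c z)^*.
  by rewrite /c conjM -expiN opprK mulrA (mulrC (expi _ _)) expi_mulN mul1r.
rewrite [RHS](_ : _ = a%:C%C *
    P (fun z => (zO f z * expi (- lam j) z) * (c z)^*) x); last first.
  by congr (_ * _); apply: eq_bigr => m _; rewrite cE mulrA.
rewrite periodizeM_periodic// /c conjM -expiN opprK /sheet; ring.
Qed.

(** After summing [sheet_adjoint] over [j], the sheets of [g] appear only at points of [Omega],
    where their sum is [g]. *)
Lemma sheets_dot (f g : vec (L2 Omega)) : dom f -> dom g ->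
  {ae mu, forall x, \sum_j sheet j f x * (sheet j g x)^* =
    a%:C%C * P (fun z => zO (fun y => f y * (g y : R[i])^*) z) x}.
Proof.
move=> df dg.
have : {ae mu, forall z,
    zO f z * (\sum_j sheet j g z)^* = zO (fun y => f y * (g y : R[i])^*) z}.
  apply: ae_imply (sheets_sum dg) => z h.
  have [Oz|Oz] := pselect (Omega z); last by rewrite !zext_out ?mul0r.
  by rewrite !zext_in// h.
move=> /(ae_periodize a M); apply: ae_imply => x <-.
rewrite (eq_bigr _ (fun j _ => sheet_adjoint j f g x)) -mulr_sumr; congr (_ * _).
rewrite /periodize exchange_big /=; apply: eq_bigr => m _.
by rewrite rmorph_sum mulr_sumr.
Qed.

(** This is the isometry of the intertwiner: the factor [a] cancels the [p] in the inner product of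
    [HT]. *)
Lemma cintegral_sheets_dot (f g : vec (L2 Omega)) : dom f -> dom g ->
  cintegral `[0, a[ (fun x => \sum_j sheet j f x * (sheet j g x)^*) =
  a%:C%C * dotp f g.
Proof.
move=> df dg; pose h y := f y * (g y : R[i])^*.
have hi : cintegrable Omega h by exact: L2_cintegrableM.
have hw : cintegrable `[- (M%:R * a), M%:R * a[ (zO h) by exact: cintegrable_zext.
have Ph : cintegrable `[0, a[ (P (zO h)) by exact: cintegrable_periodize.
rewrite /= -(cintegral_zext _ OmegaM) -cintegral_periodize// -cintegralZ//.
have msh j (u : vec (L2 Omega)) : dom u -> cmeasurable `[0, a[ (sheet j u).
  move=> [mu' _]; apply: (cmeasurableS measurableT) => //.
  exact: cmeasurable_sheet.
apply: ae_eq_cintegral => //.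
- apply: cmeasurable_sum => j; apply: cmeasurableM; first exact: msh.
  by apply: cmeasurable_conj; exact: msh.
- by apply: cintegrable_cmeasurable; exact: cintegrableZ.
- by apply: ae_imply (sheets_dot df dg) => x h' _.
Qed.

Lemma sheets_finite (f : vec (L2 Omega)) : dom f ->
  (\int[mu]_(x in `[0%R, a[) (\sum_j sqn (sheet j f x))%:E < +oo)%E.
Proof.
move=> df; pose h y := f y * (f y : R[i])^*.
have hi : cintegrable Omega h by exact: L2_cintegrableM.
have hw : cintegrable `[- (M%:R * a), M%:R * a[ (zO h) by exact: cintegrable_zext.
have [Ph _] : cintegrable `[0, a[ (fun x => a%:C%C * P (zO h) x).
  by apply: cintegrableZ => //; exact: cintegrable_periodize.
have msh j : cmeasurable `[0, a[ (sheet j f).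
  case: df => mf _; apply: (cmeasurableS measurableT) => //.
  exact: cmeasurable_sheet.
rewrite (@ae_eq_integral _ _ _ mu _
  (EFin \o (fun x => complex.Re (a%:C%C * P (zO h) x))))//.
- exact: integrable_lty Ph.
- apply/measurable_EFinP; apply: measurable_sum => j.
  exact: measurable_sqn.
- exact: measurable_int Ph.
- apply: ae_imply (sheets_dot df df) => x E _; congr (_%:E).
  rewrite -E raddf_sum; apply: eq_bigr => j _.
  exact/esym/sqn_conjM.
Qed.

(** The preimage is the sum of the [G i] on [Omega]. Each [G i] is [expi (lam i)] times a periodic
    function, so the orthogonality relations let [sheet j] retain [G j] alone. *)
Lemma sheets_surj (G : I -> R -> R[i]) :
  (forall i, cmeasurable setT (G i)) ->
  (forall i, \int[mu]_(x in `[0%R, a[) (sqn (G i x))%:E < +oo)%E ->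
  (forall i, {ae mu, forall x, forall n : int,
     G i (x + n%:~R * a) = expi (lam i) (n%:~R * a) * G i x}) ->
  exists2 f : vec (L2 Omega), dom f &
    forall j, {ae mu, forall x, sheet j f x = G j x}.
Proof.
move=> mG Gfin Gper.
(* The squared modulus of [G i] is periodic almost everywhere, so finiteness over one cell gives
   finiteness over the window. *)
have dG i : dom (G i : vec (L2 Omega)).
  split; first exact: (cmeasurableS measurableT).
  have msG : measurable_fun setT (fun x : R => (sqn (G i x))%:E).
    by apply/measurable_EFinP; exact: measurable_sqn.
  apply: (@le_lt_trans _ _
      (\int[mu]_(x in `[(- (M%:R * a))%R, (M%:R * a)%R[) (sqn (G i x))%:E)%E).
    apply: ge0_subset_integral => //; first exact: (measurable_funTS msG).
    by move=> x _; rewrite lee_fin sqn_ge0.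
  rewrite (@ge0_integral_window _ _ a_gt0 M (fun x => (sqn (G i x))%:E))//; last first.
    by move=> x; rewrite lee_fin sqn_ge0.
  apply/lte_sum_pinfty => m _; apply: le_lt_trans (Gfin i).
  rewrite le_eqVlt; apply/orP; left; apply/eqP; apply: ae_eq_integral => //.
  - apply: measurable_funTS.
    exact: measurableT_comp msG (measurable_node a_gt0 M m).
  - exact: (measurable_funTS msG).
  - apply: ae_imply (Gper i) => x h _; congr (_%:E).
    by have [n ->] := node_shift a M m x; rewrite h sqnM sqn_expi mul1r.
pose f : vec (L2 Omega) := \sum_i 1 *: (G i : vec (L2 Omega)).
have fE x : f x = \sum_i G i x.
  rewrite /f fct_sumE; apply: eq_bigr => i _; exact: mul1r.
exists f; first by apply: L2_sum => // i _; exact: dG.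
move=> j.
have := ae_forall (fun i => sheets_orthogonal i j).
apply: ae_imply2 (ae_forall Gper) => x hG hP.
(* At a node [z] of [x], [G i z] is [expi (lam i) z * expi (- lam i) x * G i x]; the last two
   factors do not depend on the node. *)
have PE : P (fun z => zO f z * expi (- lam j) z) x =
    \sum_i P (fun z => zO (expi (lam i)) z * expi (- lam j) z) x
      * (expi (- lam i) x * G i x).
  rewrite /periodize (eq_bigr (fun m : 'I_M.*2 => \sum_i
      (zO (expi (lam i)) (node a M m x) * expi (- lam j) (node a M m x))
      * (expi (- lam i) x * G i x))); last first.
    move=> m _; rewrite {1}/zext fE mulr_sumr mulr_suml; apply: eq_bigr => i _.
    have [n ->] := node_shift a M m x; rewrite hG /zext.
    rewrite [expi (lam i) (_ + _)]expi_addr.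
    have := expi_mulN (lam i) x.
    move: (expi (lam i) x) (expi (- lam i) x) => u v uv.
    rewrite [RHS](_ : _ = (u * v) * ((\1_Omega (x + n%:~R * a))%:C%C *
      (expi (lam i) (n%:~R * a) * G i x) * expi (- lam j) (x + n%:~R * a))).
      by rewrite uv mul1r.
    by ring.
  by rewrite exchange_big /=; apply: eq_bigr => i _; rewrite mulr_suml.
rewrite /sheet PE (bigD1 j)//= big1 ?addr0; last first.
  by move=> i /negbTE ij; rewrite hP ij !mul0r.
rewrite hP eqxx mul1r.
have aV : a%:C%C * (a^-1)%:C%C = 1 :> R[i] by rewrite -rmorphM mulfV ?gt_eqF.
rewrite -[RHS]mul1r -aV -[RHS]mul1r -(expi_mulN (lam j) x).
by move: a%:C%C (a^-1)%:C%C (expi _ x) (expi (- _) x) => u v e1 e2; ring.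
Qed.

Lemma sheet_translation (U : R -> vec (L2 Omega) -> vec (L2 Omega)) :
  local_translations Lambda U ->
  forall t j (f : vec (L2 Omega)), dom f ->
  {ae mu, forall x, sheet j (U t f) x = sheet j f (x + t)}.
Proof.
move=> [[Uiso _ _ _] Uexpi] t j f df.
have [Udom Usame Ulin Udot _] := Uiso t.
(* [U t] preserves inner products and has [expi l] as eigenvector; the eigenvalue leaves the second
   argument conjugated and is cancelled because it has modulus 1. *)
have coef l : Lambda l -> dotp (U t f) (expi l : vec (L2 Omega)) =
    expi l t * dotp f (expi l : vec (L2 Omega)).
  move=> Ll; have dl := spectrum_dom Ll.
  rewrite -(Udot _ _ df dl) /=.
  have -> : cintegral Omega (fun x => U t f x * (U t (expi l) x)^*) =
      cintegral Omega (fun x => (expi l t)^* * (U t f x * (expi l x)^*)).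
    apply: ae_eq_cintegral => //.
    - by apply: cintegrable_cmeasurable; apply: L2_cintegrableM => //; exact: Udom.
    - apply: cintegrable_cmeasurable; apply: cintegrableZ => //.
      by apply: L2_cintegrableM => //; exact: Udom.
    - apply: ae_imply (Uexpi l t Ll) => x h Ox.
      by rewrite h// conjM mulrCA.
  rewrite cintegralZ//; last by apply: L2_cintegrableM => //; exact: Udom.
  by rewrite mulrA -expiN expi_mulN mul1r.
(* [Q] is the sheet without its factor [a] and its character, hence periodic. The claim becomes that
   [h] vanishes almost everywhere. *)
pose Q u x := P (fun z => zO u z * expi (- lam j) z) x.
pose h x := Q (U t f) x - expi (lam j) t * Q f (x + t).
have QP u x (n : int) : Q u (x + n%:~R * a) = Q u x by rewrite /Q periodizeD.
have hP x (n : int) : h (x + n%:~R * a) = h x.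
  by rewrite /h QP addrAC QP.
have ui (u : vec (L2 Omega)) : dom u -> cintegrable Omega u by exact: L2_cintegrable.
have Qi (u : vec (L2 Omega)) : dom u -> cintegrable `[0, a[ (Q u).
  by move=> du; apply: cintegrable_periodize => //;
    apply: cintegrable_window; exact: ui.
(* The inner product conjugates its second argument, so index [k] corresponds to the frequency
   [lam j - k / a]. *)
have Qcoef (u : vec (L2 Omega)) (k : int) : dom u ->
    cintegral `[0, a[ (fun x => Q u x * expi (k%:~R / a) x) =
    dotp u (expi (lam j + (- k)%:~R / a) : vec (L2 Omega)).
  move=> du; rewrite fourier_periodize//; last exact: ui.
  by apply: eq_cintegral => x _; rewrite -expiN opprD rmorphN /= mulNr opprK.
have Qti : cintegrable `[0, a[ (fun x => Q f (x + t)).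
  exact: (cintegrable_period_shift a_gt0 (QP f) (Qi f df) t).
have Qtcoef (k : int) :
    cintegral `[0, a[ (fun x => Q f (x + t) * expi (k%:~R / a) x) =
    expi (- (k%:~R / a)) t * dotp f (expi (lam j + (- k)%:~R / a) : vec (L2 Omega)).
  rewrite -Qcoef//; set e := expi (k%:~R / a).
  have Qei : cintegrable `[0, a[ (fun x => Q f x * e x).
    by apply: cintegrableM_expi => //; exact: Qi.
  have Qeper x (n : int) : Q f (x + n%:~R * a) * e (x + n%:~R * a) = Q f x * e x.
    by rewrite QP /e expi_periodic.
  rewrite -(cintegral_period_shift a_gt0 Qeper Qei t) -cintegralZ//; last first.
    exact: (cintegrable_period_shift a_gt0 Qeper Qei t).
  apply: eq_cintegral => x _; rewrite /e expi_addr expiN.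
  have := expi_mulN (k%:~R / a) t; rewrite expiN.
  move: (expi _ t) => v vv; rewrite [RHS](_ : _ = (v * v^*) * (Q f (x + t) * e x)).
    by rewrite vv mul1r.
  by rewrite /e; ring.
have null : fourier_null a h.
  rewrite (_ : h = (fun x => Q (U t f) x +
      (- expi (lam j) t) * Q f (x + t))); last first.
    by apply/funext => x; rewrite /h mulNr.
  have Qui : cintegrable `[0, a[ (Q (U t f)) by apply: Qi; exact: Udom.
  split; first by apply: cintegrableD => //; exact: cintegrableZ.
  move=> k; under eq_cintegral do rewrite mulrDl -mulrA.
  rewrite cintegralD//; last 2 first.
  - exact: cintegrableM_expi.
  - by apply: cintegrableZ => //; exact: cintegrableM_expi.
  rewrite cintegralZ//; last exact: cintegrableM_expi.
  rewrite Qtcoef Qcoef; last exact: Udom.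
  rewrite coef; last exact: Lambda_lam.
  by rewrite expi_addl rmorphN /= mulNr mulNr mulrA subrr.
apply: ae_imply (periodic_fourier_null a_gt0 hP null) => x /eqP.
rewrite /h subr_eq0 => /eqP hx.
by rewrite /sheet -/(Q _ _) -/(Q _ _) hx expi_addr; ring.
Qed.
End PeriodicSpectrum.

(** * Diagonalization and the intertwiner *)

Section UnitaryDiagonalization.
Context {R : realType}.
Implicit Types (n : nat).

Lemma cdotE n (u v : 'cV[R[i]]_n) :
  cdot u v = ((map_mx Num.conj v^T) *m u) 0 0.
Proof. by rewrite /cdot mxE; apply: eq_bigr => i _; rewrite !mxE mulrC. Qed.

Lemma cdot_unitary n (Q : 'M[R[i]]_n) (u v : 'cV[R[i]]_n) :
  Q \is unitarymx -> cdot (Q *m u) (Q *m v) = cdot u v.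
Proof.
move=> Qu; rewrite !cdotE trmx_mul map_mxM -mulmxA (mulmxA (map_mx _ Q^T)).
have /unitarymxP : map_mx Num.conj Q^T \is unitarymx by rewrite trmxC_unitary.
by rewrite trmxCK => ->; rewrite mul1mx.
Qed.

(** [eigenvalue] is about row vectors: an eigenvector [v] becomes [v *m invmx Q] for the diagonal
    matrix, and conversely the rows of [Q] are eigenvectors. *)
Lemma eigenvalue_diag n (Q : 'M[R[i]]_n) (d : 'rV[R[i]]_n) c : Q \in unitmx ->
  eigenvalue (invmx Q *m diag_mx d *m Q) c <-> exists i, d 0 i = c.
Proof.
move=> Qu; split.
  move=> /eigenvalueP[v vT v0]; pose w := v *m invmx Q.
  have wd : w *m diag_mx d = c *: w.
    by rewrite /w scalemxAl -vT !mulmxA mulmxK.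
  have w0 : w != 0.
    by apply: contraNneq v0 => w0; rewrite -[v](mulmxKV Qu) -/w w0 mul0mx.
  clearbody w; have [i wi0] : exists i, w 0 i != 0.
    apply/existsP; apply: contraNT w0; rewrite negb_exists => /forallP h.
    by apply/eqP/rowP => i; rewrite [RHS]mxE; move: (h i); rewrite negbK => /eqP.
  exists i; move/rowP : wd => /(_ i); rewrite mul_mx_diag !mxE.
  by rewrite mulrC => /(mulIf wi0).
move=> [i <-]; apply/eigenvalueP; exists (row i Q).
  by rewrite -row_mul !mulmxA mulmxV// mul1mx row_mul row_diag_mx -scalemxAl -rowE.
apply/eqP => r0; have : row i (Q *m invmx Q) = 0 by rewrite row_mul r0 mul0mx.
by rewrite mulmxV// row1 => /rowP/(_ i)/eqP; rewrite !mxE !eqxx oner_eq0.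
Qed.

Lemma unitary_diagonalization n (T : 'M[R[i]]_n) : T \is unitarymx ->
  exists Q d, Q \is unitarymx /\ T = invmx Q *m diag_mx d *m Q.
Proof.
move=> Tu; exists (spectralmx T), (spectral_diag T).
split; first exact: spectral_unitarymx.
apply/orthomx_spectralP/normalmxP.
move/unitarymxP : (Tu) => ->.
have /unitarymxP : map_mx Num.conj T^T \is unitarymx by rewrite trmxC_unitary.
by rewrite trmxCK => ->.
Qed.

End UnitaryDiagonalization.

(** * Frequencies modulo 1/a *)

Section Frequencies.
Context {R : realType}.
Variables (a : R) (a_gt0 : 0 < a).

Lemma expi_eq1 (t : R) : expi 1 t = 1 -> exists k : int, t = k%:~R.
Proof.
move=> et; pose r := fpart 1 t.
have tE : t = r + (Num.floor t)%:~R by rewrite /r /fpart divr1 mulr1 subrK.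
exists (Num.floor t); move: (fpart_itv ltr01 t) et; rewrite -/r {1 2}tE.
rewrite expi_addr expi_int mulr1 => /andP[r0 r1] er.
have [->|rn0] := eqVneq r 0; first by rewrite add0r.
have {r0 rn0}r0 : 0 < r by rewrite lt_neqAle eq_sym rn0.
(* By the double-angle formula, [cos (2 * pi * r) = 1] would force this sine to vanish. *)
have s0 : 0 < sin (pi * r).
  by apply: sin_gt0_pi; rewrite mulr_gt0 ?pi_gt0//= gtr_pMr ?pi_gt0.
have := congr1 (@complex.Re R) er; rewrite /= mulr1.
rewrite (_ : 2 * pi * r = pi * r + pi * r); last by ring.
by rewrite cosD; have := cos2Dsin2 (pi * r); rewrite !expr2; nra.
Qed.

Lemma expi_eq (l m : R) : expi l a = expi m a -> exists k : int, l = m + k%:~R / a.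
Proof.
move=> lm; have [k kE] : exists k : int, (l - m) * a = k%:~R.
  apply: expi_eq1; rewrite (_ : expi 1 _ = expi (l - m) a); last first.
    by rewrite /expi mulr1 !mulrA.
  by rewrite expi_addl lm expi_mulN.
by exists k; rewrite -kE mulfK ?gt_eqF// addrC subrK.
Qed.

(* A smallest-index system of representatives of [lam] modulo [1/a] still
   enumerates the spectrum injectively, so the count [#|I| a = 1] leaves no
   room for repetitions. *)
Lemma frequencies_distinct (M p : nat) (Omega Lambda : set R) (lam : 'I_p -> R) :
  measurable Omega ->
  Omega `<=` `[- (M%:R * a), M%:R * a[%classic ->
  lebesgue_measure Omega = 1%E ->
  Lambda = [set x | exists (j : 'I_p) (k : int), x = lam j + k%:~R / a] ->
  has_spectrum Omega Lambda -> p%:R * a = 1 ->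
  forall i j (k : int), lam i = lam j + k%:~R / a -> i = j.
Proof.
move=> mO OM O1 LE spec pa.
pose cong (i j : 'I_p) := `[< exists k : int, lam i = lam j + k%:~R / a >].
have cong_sym i j : cong i j -> cong j i.
  move=> /asboolP[k ij]; apply/asboolP; exists (- k).
  by rewrite ij rmorphN /= mulNr addrK.
pose rep (j : 'I_p) := [forall i : 'I_p, (i < j)%N ==> ~~ cong i j].
have rep_inj (u v : 'I_p) : rep u -> rep v -> cong u v -> u = v.
  move=> /forallP ru /forallP rv uv; apply: val_inj => /=.
  case: (ltngtP u v) => // [uv'|vu'].
    by have := rv u; rewrite uv' uv.
  by have := ru v; rewrite vu' (cong_sym _ _ uv).
have rep_ex j : exists2 i, rep i & cong j i.
  (* Descent: an index that is not least in its class is congruent to a smaller one. *)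
  have [n] := ubnP (val j); elim: n j => // n IHn j; rewrite ltnS => jn.
  have [rj|] := boolP (rep j).
    by exists j => //; apply/asboolP; exists 0; rewrite mulr0z mul0r addr0.
  case/forallPn => i; rewrite negb_imply negbK => /andP[ij cij].
  have [u ru /asboolP[k iu]] := IHn i (leq_trans ij jn).
  exists u => //; move/cong_sym : cij => /asboolP[k' ji].
  by apply/asboolP; exists (k + k'); rewrite ji iu intrD; ring.
pose J := {j : 'I_p | rep j}.
have J_inj (u v : J) (k : int) : lam (val u) = lam (val v) + k%:~R / a -> u = v.
  move=> uv; apply/val_inj/rep_inj; [exact: valP|exact: valP|].
  by apply/asboolP; exists k.
have LJ : Lambda = [set x | exists (j : J) (k : int), x = lam (val j) + k%:~R / a].
  rewrite LE; apply/seteqP; split=> x [j [k ->]]; last by exists (val j), k.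
  have [u ru /asboolP[k' ->]] := rep_ex j.
  by exists (Sub u ru), (k' + k) => /=; rewrite intrD; ring.
have := card_spectrum a_gt0 mO OM O1 J_inj LJ spec; rewrite -[RHS]pa.
move=> /(mulIf (lt0r_neq0 a_gt0))/eqP; rewrite eqr_nat card_sig => /eqP cardJ.
have allrep j : rep j.
  have := cardC rep; rewrite card_ord cardJ -[RHS]addn0 => /addnI/card0_eq/(_ j).
  by rewrite !inE => /negbFE.
by move=> i j k ij; apply: rep_inj => //; apply/asboolP; exists k.
Qed.

End Frequencies.

(** * The intertwining operator *)

Section Intertwiner.
Context {R : realType}.
Local Notation mu := (@lebesgue_measure R).

(** Here [lam] is already enumerated in the order of the diagonal entries of [T] in the eigenbasis
    given by [Q]. *)
Lemma L2_HT_intertwiner (Omega Lambda : set R) (p : nat) (lam : 'I_p -> R)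
    (U : R -> vec (L2 Omega) -> vec (L2 Omega)) (T : 'M[R[i]]_p)
    (a : R) (M : nat) (Q : 'M[R[i]]_p) :
  a = p%:R^-1 -> 0 < a -> measurable Omega ->
  Omega `<=` `[- (M%:R * a), M%:R * a[%classic -> mu Omega = 1%E ->
  (forall i j (k : int), lam i = lam j + k%:~R / a -> i = j) ->
  Lambda = [set x | exists (j : 'I_p) (k : int), x = lam j + k%:~R / a] ->
  has_spectrum Omega Lambda -> local_translations Lambda U ->
  Q \is unitarymx ->
  T = invmx Q *m diag_mx (\row_i expi (lam i) a) *m Q ->
  exists W : vec (L2 Omega) -> vec (HT T),
    isometric_iso W /\
    forall (t : R) (f : vec (L2 Omega)), dom f ->
      same (W (U t f)) (UT t (W f)).
Proof.
move=> aE a_gt0 mO OM O1 lam_inj LE spec Uloc Qu TE.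
have Qunit := unitarymx_unit Qu.
have Q'u : invmx Q \is unitarymx by rewrite (invmx_unitary Qu) (trmxC_unitary Q).
have pa : p%:R * a = 1 :> R.
  by rewrite aE mulfV//; apply: contraTneq a_gt0 => p0; rewrite aE p0 invr0 ltxx.
have paC : (p%:R : R[i]) * a%:C%C = 1.
  by rewrite -(rmorph_nat (real_complex R)) -rmorphM /= pa.
pose sh := sheet a M Omega lam.
(* A shift by [a] multiplies the column of sheets by the diagonal matrix, which [invmx Q] turns into
   multiplication by [T]. *)
pose W (f : vec (L2 Omega)) : vec (HT T) := fun x => invmx Q *m \col_i sh i f x.
have W_cdot f g x : cdot (W f x) (W g x) = \sum_i sh i f x * (sh i g x)^*.
  by rewrite cdot_unitary//; apply: eq_bigr => i _; rewrite !mxE.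
have W_coord f x i : W f x i 0 = \sum_j invmx Q i j * sh j f x.
  by rewrite mxE; apply: eq_bigr => j _; rewrite mxE.
have msh i (f : vec (L2 Omega)) : dom f -> cmeasurable setT (sh i f).
  by case=> mf _; exact: cmeasurable_sheet.
have mW (f : vec (L2 Omega)) i : dom f -> cmeasurable setT (fun x => W f x i 0).
  move=> df; rewrite (_ : (fun x => _) = (fun x => \sum_j invmx Q i j * sh j f x)).
    apply: cmeasurable_sum => j; apply: cmeasurableM; last exact: msh.
    exact: cmeasurable_cst.
  by apply/funext => x; rewrite W_coord.
have m_dot (f g : vec (L2 Omega)) : dom f -> dom g ->
    cmeasurable setT (fun x => \sum_i sh i f x * (sh i g x)^*).
  move=> df dg; apply: cmeasurable_sum => i; apply: cmeasurableM; first exact: msh.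
  by apply: cmeasurable_conj; exact: msh.
(* [HT] integrates over a closed interval, the sheets over a half-open one; the endpoint is
   negligible. *)
have cc (h : R -> R[i]) : cmeasurable setT h ->
    cintegral `[0, a] h = cintegral `[0, a[ h.
  move=> [hr hi]; apply: complex_eq; rewrite /= /Rintegral integral_itv_bndo_bndc//;
    by apply/measurable_EFinP; exact: measurable_funTS.
exists W; split; last first.
  move=> t f df.
  have := ae_forall (fun j => sheet_translation a_gt0 mO OM O1 LE spec Uloc t j df).
  apply: ae_imply => x h; rewrite /UT /W; congr (_ *m _).
  by apply/colP => i; rewrite !mxE /sh h.
split.
- move=> f df; split; first by move=> i; exact: mW.
  + rewrite -aE -integral_itv_bndo_bndc; last first.
      apply/measurable_EFinP; apply: measurable_funTS.
      rewrite (_ : (fun x => _) =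
          (fun x => complex.Re (\sum_i sh i f x * (sh i f x)^*))).
        by case: (m_dot _ _ df df).
      by apply/funext => x; rewrite W_cdot.
    have := sheets_finite a_gt0 mO OM O1 lam_inj LE spec df; congr (_ < _)%E.
    apply: eq_integral => x _; congr (_%:E); rewrite W_cdot raddf_sum.
    by apply: eq_bigr => i _; rewrite -sqn_conjM.
  + apply: aeW => x; rewrite -aE /W TE -!mulmxA (mulmxA Q).
    rewrite (mulmxV Qunit) mul1mx.
    congr (_ *m _); apply/colP => i; rewrite mul_diag_mx !mxE.
    by have := sheet_quasiperiodic a_gt0 M Omega lam i f x 1; rewrite mulr1z mul1r.
- move=> f g df dg fg.
  have := ae_forall (fun j => sheet_ae a M lam j fg).
  apply: ae_imply => x h; rewrite /W; congr (_ *m _).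
  by apply/colP => i; rewrite !mxE /sh h.
- move=> c f g df dg; apply: aeW => x; rewrite /W.
  rewrite [RHS](_ : _ = c *: W f x + W g x)// /W scalemxAr -mulmxDr.
  congr (_ *m _); apply/colP => i; rewrite !mxE; exact: sheet_lin.
- move=> f g df dg; rewrite {1}/dotp /= -aE.
  rewrite (_ : (fun x => cdot _ _) = (fun x => \sum_i sh i f x * (sh i g x)^*)).
    rewrite cc; last exact: m_dot.
    rewrite (cintegral_sheets_dot a_gt0 mO OM O1 lam_inj LE spec df dg).
    by rewrite mulrA paC mul1r.
  by apply/funext => x; rewrite W_cdot.
(* In the eigenbasis the relation with [T] decouples into one scalar quasi-periodicity for each
   coordinate, as [sheets_surj] expects. *)
- move=> g [mg gfin gT]; pose G i x : R[i] := (Q *m g x) i 0.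
  have GE i x : G i x = \sum_j Q i j * g x j 0 by rewrite /G mxE.
  have mG i : cmeasurable setT (G i).
    rewrite (_ : G i = (fun x => \sum_j Q i j * g x j 0)); last first.
      by apply/funext => x; rewrite GE.
    apply: cmeasurable_sum => j; apply: cmeasurableM => //; exact: cmeasurable_cst.
  have G_sqn x : \sum_i sqn (G i x) = complex.Re (cdot (g x) (g x)).
    rewrite -(cdot_unitary _ _ Qu) raddf_sum; apply: eq_bigr => i _.
    by rewrite -sqn_conjM.
  have msG i : measurable_fun setT (fun x : R => sqn (G i x)) by exact: measurable_sqn.
  have Gfin i : (\int[mu]_(x in `[0%R, a[) (sqn (G i x))%:E < +oo)%E.
    apply: le_lt_trans gfin; rewrite -aE.
    apply: (@le_trans _ _ (\int[mu]_(x in `[0%R, a]) (sqn (G i x))%:E)%E).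
      apply: ge0_subset_integral => //.
      - by apply/measurable_EFinP; exact: (measurable_funTS (msG i)).
      - by move=> x _; rewrite lee_fin sqn_ge0.
      - by apply: subset_itvl; rewrite bnd_simp.
    apply: ge0_le_integral => //.
    - by move=> x _; rewrite lee_fin sqn_ge0.
    - by apply/measurable_EFinP; exact: (measurable_funTS (msG i)).
    - rewrite (_ : (fun x => _) = EFin \o (fun x => \sum_i sqn (G i x))); last first.
        by apply/funext => x /=; rewrite G_sqn.
      by apply/measurable_EFinP; apply: measurable_funTS; exact: measurable_sum.
    - move=> x _; rewrite lee_fin -G_sqn (bigD1 i)//= lerDl.
      by apply: sumr_ge0 => k _; exact: sqn_ge0.
  have Gstep i : {ae mu, forall x, G i (x + a) = expi (lam i) a * G i x}.
    apply: ae_imply gT => x; rewrite -aE /G => ->.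
    by rewrite TE !mulmxA mulmxV// mul1mx -mulmxA mul_diag_mx !mxE.
  have Gper i : {ae mu, forall x, forall n : int,
      G i (x + n%:~R * a) = expi (lam i) (n%:~R * a) * G i x}.
    have := ae_shift_int a (Gstep i); apply: ae_imply => x h.
    elim/int_rect => [|n IHn|n IHn].
    + by rewrite mulr0z mul0r addr0 expi0r mul1r.
    + have -> : n.+1%:Z%:~R * a = n%:~R * a + a.
        by rewrite -addn1 PoszD intrD mulr1z; ring.
      by rewrite addrA h IHn [in RHS]addrC expi_addr mulrA.
    (* Going down, [h] at [- n.+1] links the values at [- n.+1] and [- n]; the factor
       [expi (lam i) a] is nonzero and can be cancelled. *)
    + apply: (@mulfI _ (expi (lam i) a)).
        by apply/negP => /eqP e0; have := expi_mulN (lam i) a; rewrite e0 mul0r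
          => /esym/eqP; rewrite oner_eq0.
      have := h (- n.+1%:Z); rewrite mulrA -expi_addr.
      have -> : x + (- n.+1%:Z)%:~R * a + a = x + (- n%:Z)%:~R * a.
        by rewrite !rmorphN /= -addn1 PoszD intrD mulr1z; ring.
      move=> <-; rewrite IHn; congr (expi _ _ * _).
      by rewrite !rmorphN /= -addn1 PoszD intrD mulr1z; ring.
  have [f df fG] := sheets_surj a_gt0 mO OM O1 lam_inj LE spec mG Gfin Gper.
  exists f => //; have := ae_forall fG; apply: ae_imply => x h.
  rewrite /W (_ : (\col_i sh i f x) = Q *m g x).
    by rewrite mulmxA mulVmx// mul1mx.
  by apply/colP => i; rewrite mxE /sh h.
Qed.

End Intertwiner.

Theorem proposition2p14 (R : realType) (Omega Lambda : set R) (p : nat)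
    (lam : 'I_p -> R) (p_gt0 : (0 < p)%N)
    (U : R -> vec (L2 Omega) -> vec (L2 Omega)) (T : 'M[R[i]]_p)
    (Omega_bounded : bounded_set Omega)
    (Omega_borel : measurable Omega)
    (Omega_measure : lebesgue_measure Omega = 1%E)
    (Lambda_spectrum : has_spectrum Omega Lambda)
    (Lambda_period : has_period Lambda p%:R)
    (lam0 : lam (Ordinal p_gt0) = 0)
    (LambdaE : Lambda =
       [set x | exists (j : 'I_p) (k : int), x = lam j + p%:R * k%:~R])
    (U_local : local_translations Lambda U)
    (T_unitary : T \is unitarymx)
    (T_eigenvalues :
       forall a : R[i], eigenvalue T a <-> exists j : 'I_p, a = expi (lam j) p%:R^-1) :
  exists W : vec (L2 Omega) -> vec (HT T),
    isometric_iso W /\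
    forall (t : R) (f : vec (L2 Omega)), dom f ->
      same (W (U t f)) (UT t (W f)).
Proof.
pose a : R := p%:R^-1.
have a_gt0 : 0 < a by rewrite invr_gt0 ltr0n.
have pE (k : int) : p%:R * k%:~R = k%:~R / a :> R by rewrite /a invrK mulrC.
have pa : p%:R * a = 1 :> R by rewrite /a mulfV// pnatr_eq0 -lt0n.
have LE : Lambda = [set x | exists (j : 'I_p) (k : int), x = lam j + k%:~R / a].
  rewrite LambdaE; apply/seteqP; split=> x [j [k ->]]; exists j, k;
    by rewrite pE.
have [M OM] : exists M : nat, Omega `<=` `[- (M%:R * a), M%:R * a[%classic.
  have [K K0 hK] := pinfty_ex_gt0 Omega_bounded.
  have KM : K / a < (Num.bound (K / a))%:R.
    by apply: archi_boundP; rewrite divr_ge0// ltW.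
  exists (Num.bound (K / a)) => x /hK; rewrite /= ler_norml in_itv/=.
  rewrite ltr_pdivrMr// in KM => /andP[h1 h2].
  by rewrite (le_lt_trans h2 KM) andbT; apply: le_trans h1; rewrite lerN2 ltW.
have lam_inj := frequencies_distinct a_gt0 Omega_borel OM Omega_measure LE
  Lambda_spectrum pa.
have [Q [d [Qu TE]]] := unitary_diagonalization T_unitary.
have Qunit := unitarymx_unit Qu.
have eig c : (exists i, d 0 i = c) <-> exists j : 'I_p, c = expi (lam j) a.
  by rewrite -T_eigenvalues TE; apply: iff_sym; exact: eigenvalue_diag.
(* Only the set of eigenvalues is given. [tau] names the frequency behind each diagonal entry, and
   [sigma] below picks an entry for each frequency. *)
have /fin_all_exists[tau tauE] : forall i, exists j, d 0 i = expi (lam j) a.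
  by move=> i; apply/eig; exists i.
have expi_inj i j : expi (lam i) a = expi (lam j) a -> i = j.
  by move=> /(expi_eq a_gt0)[k]; exact: lam_inj.
have /fin_all_exists[sigma sigmaE] : forall j, exists i, tau i = j.
  move=> j; have [i dij] : exists i, d 0 i = expi (lam j) a by apply/eig; exists j.
  by exists i; apply: expi_inj; rewrite -tauE.
(* An injective self-map of a finite type is bijective, so [tau] is a permutation: every eigenvalue
   is simple. *)
have sigma_bij : bijective sigma by apply: injF_bij; exact: can_inj sigmaE.
have tau_inj : injective tau.
  exact: bij_inj (bij_can_bij sigma_bij sigmaE).
apply: (@L2_HT_intertwiner _ _ _ _ (lam \o tau) _ _ a M Q);
  [exact: erefl|exact: a_gt0|exact: Omega_borel|exact: OM|exact: Omega_measure
  | | |exact: Lambda_spectrum|exact: U_local|exact: Qu|].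
- by move=> i j k /lam_inj/tau_inj.
- rewrite LE; apply/seteqP; split=> x [j [k ->]].
    by exists (sigma j), k; rewrite /= sigmaE.
  by exists (tau j), k.
- rewrite (_ : (\row_i _) = d); first exact: TE.
  by apply/rowP => i; rewrite mxE tauE.
Qed.
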